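(* Let $\gamma\ge1$. Let $\{a_n\}_{n\in\mathbb Z}$ with $a_n>0$ and $\{b_n\}_{n\in\mathbb Z}$ with $b_n\in\mathbb R$ be sequences such that $\{b_n\},\{a_n-1\}\in\ell^{\gamma+1/2}(\mathbb Z)$. Let $W$ be the Jacobi operator on $\ell^2(\mathbb Z)$ $$Wu(n)=a_{n-1}u(n-1)+b_nu(n)+a_nu(n+1),\qquad n\in\mathbb Z,$$ whose essential spectrum is $[-2,2]$, and let $E_1^+>E_2^+>\dots>2$ and $E_1^-<E_2^-<\dots<-2$ be its (simple) eigenvalues outside $[-2,2]$. Then $$\sum_j |E_j^-+2|^\gamma+\sum_j|E_j^+-2|^\gamma\le 3^{\gamma-1/2}\,\frac{\pi}{\sqrt3}\,L^{cl}_{\gamma,1}\Big(\sum_{n\in\mathbb Z}|b_n|^{\gamma+1/2}+4\sum_{n\in\mathbb Z}|a_n-1|^{\gamma+1/2}\Big),$$ where $L^{cl}_{\gamma,1}=\dfrac{\Gamma(\gamma+1)}{2\sqrt\pi\,\Gamma(\gamma+3/2)}$. *)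

(* Defs.v *)
From mathcomp Require Import all_boot all_order all_algebra.
From mathcomp Require Import all_classical all_reals all_analysis.
Set Implicit Arguments. Unset Strict Implicit. Unset Printing Implicit Defensive.
Import Order.TTheory GRing.Theory Num.Theory.
Import numFieldNormedType.Exports.
Local Open Scope classical_set_scope.
Local Open Scope ring_scope.

(* Euler's Gamma function, Gamma s = int_0^oo t^(s-1) e^(-t) dt (Lebesgue integral;
   meaningful for s > 0, where the integral is finite). *)
Definition Gamma {R : realType} (s : R) : R :=
  fine (\int[@lebesgue_measure R]_(t in `[0%R, +oo[%classic)
          ((t `^ (s - 1)) * expR (- t))%:E)%E.

Definition Lcl {R : realType} (g : R) : R :=
  Gamma (g + 1) / (2 * Num.sqrt pi * Gamma (g + 3 / 2)).

Definition lp_sum {R : realType} (p : R) (x : int -> R) : \bar R :=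
  (\esum_(n in [set: int]) (`|x n| `^ p)%:E)%E.

Definition in_lp {R : realType} (p : R) (x : int -> R) : Prop :=
  (lp_sum p x < +oo)%E.

Definition jacobi {R : realType} (a b u : int -> R) (n : int) : R :=
  a (n - 1) * u (n - 1) + b n * u n + a n * u (n + 1).

Definition jacobi_eigenvalue {R : realType} (a b : int -> R) (E : R) : Prop :=
  exists u : int -> R, in_lp 2 u /\ u <> (fun _ => 0) /\
    forall n, jacobi a b u n = E * u n.

(* Main.v *)
(** Let [psi_j] be orthonormal eigenvectors for finitely many eigenvalues
    [E_j > 2 + t] and [rho = sum_j psi_j^2]. By AM-GM the Jacobi form is at most the
    form of the free operator plus [V n = max(b n, 0) + |a n - 1| + |a (n-1) - 1|], so
    [sum_j (E_j - 2 - t) <= sum_n (V n - t) rho n - sum_j |D psi_j|^2]. The discrete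
    Agmon inequality [phi(n)^4 <= |phi|^2 |D phi|^2], applied to
    [phi = sum_j psi_j(n) psi_j], gives [sum_n rho(n)^3 <= sum_j |D psi_j|^2], and
    maximizing [x r - r^3] over [r] yields
    [sum_j (E_j - 2 - t) <= 2 sum_n ((V n - t)_+ / 3)^(3/2)]. This is the case
    [g = 1] at [t = 0]; for [g > 1] integrate it against [t^(g-2) dt] and evaluate the
    constants with Euler's Beta identity (Aizenman-Lieb). Eigenvalues below [-2] are
    those of [(a, -b)] above [2], through [u n |-> (-1)^n u n], and the three terms of
    [V] are separated by convexity of the power function. *)

Require Import Defs.
From mathcomp Require Import all_boot all_order all_algebra finmap.
From mathcomp Require Import all_classical all_reals all_analysis.
From mathcomp Require Import zify ring lra measurable_realfun.
Import Order.TTheory GRing.Theory Num.Theory.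
Import numFieldNormedType.Exports.
Local Open Scope classical_set_scope.
Local Open Scope ring_scope.

(** * Beta and Gamma integrals *)

Section Integrals.
Set Implicit Arguments.
Unset Strict Implicit.
Context {R : realType}.
Implicit Types (q s t v x : R).
Local Notation mu := (@lebesgue_measure R).

(** For [q > 0] the power is extended by zero to the negative axis, so that all integrals run over
    the whole line and the cutoffs are built into the integrands. *)
Definition pospow q v : R := Num.max v 0 `^ q.

Lemma pospow_ge0 q v : 0 <= pospow q v.
Proof. exact: powR_ge0. Qed.

Lemma pospowE q v : 0 <= v -> pospow q v = v `^ q.
Proof. by move=> v0; rewrite /pospow max_l. Qed.

Lemma pospow_le0 q v : 0 < q -> v <= 0 -> pospow q v = 0.
Proof. by move=> q0 v0; rewrite /pospow max_r// powR0// gt_eqF. Qed.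

Lemma pospowM q c v : 0 <= c -> pospow q (c * v) = c `^ q * pospow q v.
Proof.
move=> c0; rewrite /pospow -powRM ?le_max ?lexx ?orbT//.
by rewrite maxr_pMr// mulr0.
Qed.

Lemma pospow1 v : pospow 1 v = Num.max v 0.
Proof. by rewrite /pospow powRr1// le_max lexx orbT. Qed.

Lemma pospow_3half v : pospow (3 / 2) v = Num.max v 0 * Num.sqrt (Num.max v 0).
Proof.
rewrite /pospow; have : 0 <= Num.max v 0 by rewrite le_max lexx orbT.
set m := Num.max v 0; rewrite le_eqVlt => /predU1P[<-|m0].
  by rewrite mul0r powR0// gt_eqF//; lra.
have -> : (3 / 2 : R) = 1 + 2^-1 by lra.
by rewrite powRD ?(gt_eqF m0) ?implybT// powRr1 ?ltW// powR12_sqrt ?ltW.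
Qed.

Lemma measurable_pospow q : measurable_fun setT (pospow q).
Proof.
apply: (measurableT_comp (measurable_powR q)).
by apply: measurable_maxr => //; exact: measurable_cst.
Qed.

(** Continuity enters through the changes of variables below, which are only ever made with the
    exponents [1] and [3 / 2]. *)
Lemma continuous_pospow1 : continuous (pospow 1).
Proof.
rewrite (_ : pospow 1 = idfun \max cst 0); last first.
  by apply/funext => v; rewrite pospow1.
apply: max_fun_continuous => x; first exact: cvg_id.
exact: cst_continuous.
Qed.

Lemma continuous_pospow_3half : continuous (pospow (3 / 2)).
Proof.
rewrite (_ : pospow (3 / 2) = fun v => pospow 1 v * Num.sqrt (pospow 1 v)).
  move=> x; apply: cvgM; first exact: continuous_pospow1.
  apply: (@continuous_comp _ _ _ (pospow 1) Num.sqrt).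
    exact: continuous_pospow1.
  exact: sqrt_continuous.
by apply/funext => v; rewrite pospow_3half pospow1.
Qed.

Lemma ge0_integral_shift (G : R -> R) (c : R) : continuous G ->
  (forall x, 0 <= G x) ->
  (\int[mu]_x (G x)%:E = \int[mu]_x (G (x + c))%:E)%E.
Proof.
move=> cG G0.
have dF x : is_derive x 1 (fun x : R => x + c) 1.
  by apply: is_derive_eq; rewrite addr0.
have F'E : derive1 (fun x : R => x + c) = cst 1.
  by apply/funext => x; rewrite derive1E; exact: derive_val.
rewrite (@increasing_ge0_integration_by_substitutionT _ (fun x => x + c))//.
- by rewrite F'E; apply: eq_integral => x _ /=; rewrite /GRing.mul/= mulr1.
- by move=> x y xy; rewrite ltrD2r.
- by rewrite F'E => x; exact: cvg_cst.
- by rewrite F'E; exact: is_cvg_cst.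
- by rewrite F'E; exact: is_cvg_cst.
- exact: cvg_addrr_Ny.
- exact: cvg_addrr.
Qed.

(* [Gamma (q + 1)] for [q > 0]. *)
Definition gamma_int q : \bar R := (\int[mu]_v (pospow q v * expR (- v))%:E)%E.

(* [B(s, q + 1)] for [s, q > 0], by the substitution [t = e^x]. *)
Definition beta_int s q : \bar R :=
  (\int[mu]_x (expR (s * x) * pospow q (1 - expR x))%:E)%E.

(* [Gamma s] for [s > 0], by the substitution [t = e^x]. *)
Definition mellin_int s : \bar R :=
  (\int[mu]_x (expR (s * x) * expR (- expR x))%:E)%E.

Lemma continuous_expRM s : continuous (fun x : R => expR (s * x)).
Proof.
move=> x; apply: continuous_comp; last exact: continuous_expR.
by apply: continuousM => //; exact: cst_continuous.
Qed.

Lemma gamma_int_shift q t : continuous (pospow q) ->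
  (\int[mu]_v (pospow q (v - t) * expR (- v))%:E
   = (expR (- t))%:E * gamma_int q)%E.
Proof.
move=> cq; rewrite (@ge0_integral_shift _ t); first last.
- by move=> x; rewrite mulr_ge0 ?pospow_ge0 ?expR_ge0.
- move=> x; apply: cvgM.
    apply: (@continuous_comp _ _ _ (fun v => v - t) (pospow q)); last exact: cq.
    by apply: cvgB => //; exact: cvg_cst.
  by apply: continuous_comp; [exact: continuousN|exact: continuous_expR].
rewrite /gamma_int -ge0_integralZl_EFin ?expR_ge0//.
- apply: eq_integral => x _; rewrite -EFinM addrK opprD expRD.
  by congr EFin; ring.
- by move=> x _; rewrite lee_fin mulr_ge0 ?pospow_ge0 ?expR_ge0.
- apply/measurable_EFinP/measurable_funM; first exact: measurable_pospow.
  exact: measurableT_comp.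
Qed.

Lemma measurable_beta s q v :
  measurable_fun setT (fun x => expR (s * x) * pospow q (v - expR x)).
Proof.
apply: measurable_funM.
  by apply: measurableT_comp => //; exact: measurable_funM.
apply: (measurableT_comp (measurable_pospow q)).
by apply: measurable_funB => //; exact: measurable_expR.
Qed.

(** For [v > 0] the translation [x -> x + ln v], a dilation in [e^x], pulls out [v^(s + q)]. For
    [v <= 0] both sides vanish. *)
Lemma beta_int_scale s q v : 0 < s -> 0 < q -> continuous (pospow q) ->
  (\int[mu]_x (expR (s * x) * pospow q (v - expR x))%:E
   = (pospow (s + q) v)%:E * beta_int s q)%E.
Proof.
move=> s0 q0 cq; have [v0|v0] := leP v 0.
  rewrite (pospow_le0 (addr_gt0 s0 q0) v0) mul0e integral0_eq// => x _.
  by rewrite pospow_le0 ?mulr0//; have := expR_gt0 x; lra.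
rewrite (@ge0_integral_shift _ (ln v)); first last.
- by move=> x; rewrite mulr_ge0 ?pospow_ge0 ?expR_ge0.
- move=> x; apply: cvgM; first exact: continuous_expRM.
  apply: (@continuous_comp _ _ _ (fun x => v - expR x) (pospow q)); last exact: cq.
  by apply: cvgB; [exact: cvg_cst|exact: continuous_expR].
rewrite /beta_int -ge0_integralZl_EFin ?pospow_ge0//.
- apply: eq_integral => x _ /=; rewrite -EFinM.
  rewrite (pospowE (s + q) (ltW v0)) powRD ?(gt_eqF v0) ?implybT//.
  rewrite mulrDr !expRD [s * ln v]mulrC (expRM (ln v)) lnK ?posrE//.
  rewrite (_ : v - expR x * v = v * (1 - expR x)); last by ring.
  rewrite pospowM ?ltW//; congr EFin; ring.
- by move=> x _; rewrite lee_fin mulr_ge0 ?pospow_ge0 ?expR_ge0.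
- by apply/measurable_EFinP; exact: measurable_beta.
Qed.

(* The Euler identity [B(s, q+1) Gamma(s+q+1) = Gamma(s) Gamma(q+1)]. *)
Lemma beta_gamma s q : 0 < s -> 0 < q -> continuous (pospow q) ->
  (beta_int s q * gamma_int (s + q) = mellin_int s * gamma_int q)%E.
Proof.
move=> s0 q0 cq.
(* Integrating [f] first in [x] scales out a Beta integral, integrating first in [v] shifts out a
   Gamma integral; Tonelli equates the two. *)
pose f (z : R * R) : \bar R :=
  (expR (- z.1) * (expR (s * z.2) * pospow q (z.1 - expR z.2)))%:E.
have mf : measurable_fun setT f.
  apply/measurable_EFinP/measurable_funM.
    by apply: measurableT_comp => //; exact: measurableT_comp.
  apply: measurable_funM.
    by apply: measurableT_comp => //; exact: measurable_funM.
  apply: (measurableT_comp (measurable_pospow q)).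
  by apply: measurable_funB => //; exact: measurableT_comp.
have f0 z : (0 <= f z)%E.
  by rewrite lee_fin !mulr_ge0 ?pospow_ge0 ?expR_ge0.
have Ev v : (\int[mu]_x f (v, x)
    = (pospow (s + q) v * expR (- v))%:E * beta_int s q)%E.
  transitivity (\int[mu]_x ((expR (- v))%:E
      * (expR (s * x) * pospow q (v - expR x))%:E))%E.
    by apply: eq_integral => x _; rewrite -EFinM.
  rewrite ge0_integralZl_EFin; [|exact: measurableT| | |exact: expR_ge0]; last 2 first.
  - by move=> x _; rewrite lee_fin mulr_ge0 ?pospow_ge0 ?expR_ge0.
  - by apply/measurable_EFinP; exact: measurable_beta.
  by rewrite beta_int_scale// muleA -EFinM [expR _ * _]mulrC.
have Ex x : (\int[mu]_v f (v, x)
    = (expR (s * x) * expR (- expR x))%:E * gamma_int q)%E.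
  transitivity (\int[mu]_v ((expR (s * x))%:E
      * (pospow q (v - expR x) * expR (- v))%:E))%E.
    by apply: eq_integral => v _; rewrite -EFinM; congr EFin => /=; ring.
  rewrite ge0_integralZl_EFin; [|exact: measurableT| | |exact: expR_ge0]; last 2 first.
  - by move=> v _; rewrite lee_fin mulr_ge0 ?pospow_ge0 ?expR_ge0.
  - apply/measurable_EFinP/measurable_funM; last exact: measurableT_comp.
    apply: (measurableT_comp (measurable_pospow q)).
    exact: measurable_funB.
  by rewrite gamma_int_shift// muleA -EFinM.
transitivity (\int[mu]_v \int[mu]_x f (v, x))%E.
  under eq_integral do rewrite Ev.
  rewrite ge0_integralZr//.
  - by rewrite muleC.
  - apply/measurable_EFinP/measurable_funM; first exact: measurable_pospow.
    exact: measurableT_comp.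
  - by move=> v _; rewrite lee_fin mulr_ge0 ?pospow_ge0 ?expR_ge0.
  - by apply: integral_ge0 => x _; rewrite lee_fin mulr_ge0 ?pospow_ge0 ?expR_ge0.
rewrite (@fubini_tonelli _ _ _ _ _ mu mu f mf f0).
under eq_integral do rewrite Ex.
  rewrite ge0_integralZr//.
- apply/measurable_EFinP/measurable_funM.
    by apply: measurableT_comp => //; exact: measurable_funM.
  by apply: measurableT_comp => //; exact: measurableT_comp.
- by apply: integral_ge0 => x _; rewrite lee_fin mulr_ge0 ?pospow_ge0 ?expR_ge0.
Qed.

End Integrals.

(** * Values, finiteness and positivity of the Gamma integrals *)

Section IntegralValues.
Set Implicit Arguments.
Unset Strict Implicit.
Context {R : realType}.
Implicit Types (q s t v x : R).
Local Notation mu := (@lebesgue_measure R).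

(** The integrand vanishes outside [[- sqrt v, sqrt v]] and has the primitive [v x - x^3 / 3]
    inside. This links the exponents [1] and [3 / 2]. *)
Lemma integral_parabola v :
  (\int[mu]_x (pospow 1 (v - x ^+ 2))%:E = (4 / 3 * pospow (3 / 2) v)%:E)%E.
Proof.
have [v0|v0] := leP v 0.
  rewrite pospow_le0 ?divr_gt0// mulr0 integral0_eq// => x _.
  by rewrite pospow_le0//; have := sqr_ge0 x; lra.
pose w := Num.sqrt v.
have w0 : 0 < w by rewrite sqrtr_gt0.
have wv : w ^+ 2 = v by rewrite sqr_sqrtr// ltW.
transitivity (\int[mu]_(x in `[(- w)%R, w]) (w ^+ 2 - x ^+ 2)%:E)%E.
  rewrite [RHS]integral_mkcond; apply: eq_integral => x _.
  rewrite pospow1 patchE; case: ifPn => [|].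
    rewrite inE/= in_itv/= => /andP[x1 x2].
    by rewrite -wv max_l// subr_sqr mulr_ge0//; lra.
  move=> xw; rewrite max_r// -wv subr_sqr.
  have [wx|xw'] := ltP w x; first by rewrite nmulr_rle0; lra.
  have [wx|xw''] := ltP x (- w); first by rewrite pmulr_rle0; lra.
  by move: xw; rewrite notin_setE/= in_itv/= xw' xw''.
have dF x : is_derive x 1 (fun x : R => w ^+ 2 * x - x ^+ 3 / 3) (w ^+ 2 - x ^+ 2).
  by apply: is_derive_eq; rewrite /GRing.scale/=; field.
have cF : continuous (fun x : R => w ^+ 2 * x - x ^+ 3 / 3).
  by move=> x; apply/differentiable_continuous/derivable1_diffP/ex_derive.
rewrite (@continuous_FTC2 _ _ (fun x => w ^+ 2 * x - x ^+ 3 / 3)).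
- rewrite -EFinB pospow_3half max_l ?ltW// -/w -[X in 4 / 3 * (X * _)]wv.
  by congr EFin; field.
- by lra.
- apply: continuous_subspaceT => x; apply: cvgB; first exact: cvg_cst.
  exact: exprn_continuous.
- split.
  + by move=> x _; exact: ex_derive.
  + exact/cvg_at_right_filter/cF.
  + exact/cvg_at_left_filter/cF.
- by move=> x _; rewrite derive1E; exact: derive_val.
Qed.

(* Both sides are [\int\int (v - x^2)_+ e^-v dv dx], so that
   [Gamma(5/2) = 3 sqrt(pi) / 4 * Gamma(2)]. *)
Lemma gamma_int_3half :
  ((4 / 3)%:E * gamma_int (3 / 2 : R) = (Num.sqrt pi)%:E * gamma_int 1)%E.
Proof.
pose f (z : R * R) : \bar R :=
  (expR (- z.1) * pospow 1 (z.1 - z.2 ^+ 2))%:E.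
have msq : measurable_fun [set: R] (fun x : R => x ^+ 2).
  exact: measurable_funX.
have mf : measurable_fun setT f.
  apply/measurable_EFinP/measurable_funM.
    by apply: measurableT_comp => //; exact: measurableT_comp.
  apply: (measurableT_comp (measurable_pospow 1)).
  apply: measurable_funB => //.
  by apply: (@measurableT_comp _ _ _ _ _ _ (fun x : R => x ^+ 2)).
have f0 z : (0 <= f z)%E by rewrite lee_fin mulr_ge0 ?pospow_ge0 ?expR_ge0.
have Ev v : (\int[mu]_x f (v, x)
    = (4 / 3)%:E * (pospow (3 / 2) v * expR (- v))%:E)%E.
  transitivity (\int[mu]_x ((expR (- v))%:E * (pospow 1 (v - x ^+ 2))%:E))%E.
    by apply: eq_integral => x _; rewrite -EFinM.
  rewrite ge0_integralZl_EFin; [|exact: measurableT| | |exact: expR_ge0]; last 2 first.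
  - by move=> x _; rewrite lee_fin pospow_ge0.
  - apply/measurable_EFinP/(measurableT_comp (measurable_pospow 1)).
    exact: measurable_funB.
  by rewrite integral_parabola -!EFinM; congr EFin; ring.
(* The shift by [t = x^2] leaves the factor [e^(- x^2)], whose integral is [sqrt pi]. *)
have Ex x : (\int[mu]_v f (v, x) = (gauss_fun x)%:E * gamma_int 1)%E.
  rewrite -gamma_int_shift; last exact: continuous_pospow1.
  by apply: eq_integral => v _; rewrite /f mulrC.
transitivity (\int[mu]_v \int[mu]_x f (v, x))%E.
  under eq_integral do rewrite Ev.
  rewrite ge0_integralZl_EFin//.
  - by move=> x _; rewrite lee_fin mulr_ge0 ?pospow_ge0 ?expR_ge0.
  - apply/measurable_EFinP/measurable_funM; first exact: measurable_pospow.
    exact: measurableT_comp.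
rewrite (@fubini_tonelli _ _ _ _ _ mu mu f mf f0).
under eq_integral do rewrite Ex.
  rewrite ge0_integralZr//.
- by rewrite integralT_gauss.
- by apply/measurable_EFinP; exact: measurable_gauss_fun.
- by move=> x _; rewrite lee_fin gauss_fun_ge0.
- by apply: integral_ge0 => x _; rewrite lee_fin mulr_ge0 ?pospow_ge0 ?expR_ge0.
Qed.

(** Raise [y <= 1 + y <= e^y] at [y = v / (2 q)] to the power [q]. *)
Lemma powR_le_expR_half q v : 0 < q -> 0 <= v ->
  v `^ q <= (2 * q) `^ q * expR (v / 2).
Proof.
move=> q0 v0; rewrite {1}(_ : v = (2 * q) * (v / (2 * q))); last first.
  by field; lra.
have vq : 0 <= v / (2 * q) by rewrite divr_ge0//; lra.
rewrite powRM//; last by lra.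
rewrite ler_wpM2l ?powR_ge0//.
rewrite (_ : v / 2 = v / (2 * q) * q); last by field; lra.
rewrite expRM; apply: ge0_ler_powR; rewrite ?nnegrE ?expR_ge0 ?(ltW q0)//.
by rewrite (le_trans _ (expR_ge1Dx _))// lerDr.
Qed.

Lemma gamma_int_lty q : 0 < q -> (gamma_int q < +oo)%E.
Proof.
(* The leading [2] offsets the normalization [1 / 2] of the exponential density that dominates the
   integrand. *)
move=> q0; pose C := 2 * (2 * q) `^ q.
have C0 : 0 <= C by rewrite mulr_ge0 ?powR_ge0.
have mE : measurable_fun setT (EFin \o exponential_pdf (2^-1 : R)).
  by apply/measurable_EFinP; exact: measurable_exponential_pdf.
have E0 x : [set: R] x -> (0 <= (EFin \o exponential_pdf (2^-1 : R)) x)%E.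
  by rewrite lee_fin exponential_pdf_ge0.
apply: (@le_lt_trans _ _ (\int[mu]_v (C%:E * (EFin \o exponential_pdf (2^-1 : R)) v))%E).
  apply: ge0_le_integral => //.
  - by move=> v _; rewrite lee_fin mulr_ge0 ?pospow_ge0 ?expR_ge0.
  - apply/measurable_EFinP/measurable_funM; first exact: measurable_pospow.
    exact: measurableT_comp.
  - exact: emeasurable_funM.
  move=> v _; rewrite /= -EFinM lee_fin.
  have [v0|v0] := ltP v 0.
    by rewrite pospow_le0 ?(ltW v0)// mul0r mulr_ge0// exponential_pdf_ge0.
  rewrite pospowE// exponential_pdfE// /C.
  rewrite (_ : - v = - (v / 2) + - 2^-1 * v); last by lra.
  rewrite expRD mulrA (_ : 2 * _ * _ = (2 * q) `^ q * expR (- 2^-1 * v)); last first.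
    by field.
  rewrite ler_wpM2r ?expR_ge0// expRN ler_pdivrMr ?expR_gt0//.
  exact: powR_le_expR_half.
rewrite ge0_integralZl_EFin// integral_exponential_pdf ?invr_gt0//.
by rewrite mule1 ltry.
Qed.

Lemma integral_gt0 (f : R -> R) (a c : R) : measurable_fun setT f ->
  (forall x, 0 <= f x) -> 0 < c -> (forall x, a <= x <= a + 1 -> c <= f x) ->
  (0 < \int[mu]_x (f x)%:E)%E.
Proof.
move=> mf f0 c0 cf.
apply: (@lt_le_trans _ _ (\int[mu]_(x in `[a, (a + 1)%R]) (cst c%:E x))%E).
  rewrite integral_cst//= lebesgue_measure_itv/= lte_fin ltrDl ltr01.
  by rewrite -EFinB addrAC subrr add0r mule1 lte_fin.
apply: (@le_trans _ _ (\int[mu]_(x in `[a, (a + 1)%R]) (f x)%:E)%E).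
  apply: ge0_le_integral => //.
  - by move=> x _; rewrite lee_fin ltW.
  - by apply/measurable_EFinP/measurable_funTS.
apply: ge0_subset_integral => //.
  by apply/measurable_EFinP.
by move=> x _; rewrite lee_fin.
Qed.

Lemma gamma_int_gt0 q : 0 < q -> (0 < gamma_int q)%E.
Proof.
move=> q0; apply: (@integral_gt0 _ 1 (expR (- 2))).
- apply/measurable_funM; first exact: measurable_pospow.
  exact: measurableT_comp.
- by move=> v; rewrite mulr_ge0 ?pospow_ge0 ?expR_ge0.
- exact: expR_gt0.
- move=> v /andP[v1 v2]; rewrite -[leLHS]mul1r ler_pM ?expR_ge0//.
    rewrite pospowE; last by lra.
    apply: (@le_trans _ _ (1 `^ q)); first by rewrite powR1.
    apply: ge0_ler_powR; rewrite ?nnegrE ?(ltW q0)//; lra.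
  by rewrite ler_expR; lra.
Qed.

Lemma measurable_mellin s :
  measurable_fun setT (fun x : R => expR (s * x) * expR (- expR x)).
Proof.
apply/measurable_funM.
  by apply: measurableT_comp => //; exact: measurable_funM.
by apply: measurableT_comp => //; exact: measurableT_comp.
Qed.

Lemma mellin_int_gt0 s : (0 < mellin_int s)%E.
Proof.
apply: (@integral_gt0 _ 0 (expR (- `|s|) * expR (- expR 1))).
- exact: measurable_mellin.
- by move=> v; rewrite mulr_ge0 ?expR_ge0.
- by rewrite mulr_gt0 ?expR_gt0.
- move=> x; rewrite add0r => /andP[x0 x1].
  rewrite ler_pM ?expR_ge0// ler_expR ?lerN2 ?ler_expR//.
  rewrite lerNl (le_trans (ler_norm _))// normrN normrM (ger0_norm x0).
  by rewrite ler_piMr.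
Qed.

(** The integrand is at most [C e^(- s |x|)]: for [x <= 0] because [e^(- e^x) <= 1], for [x > 0]
    because [e^(- e^x)] absorbs [e^(2 s x) = (e^x)^(2 s)]. *)
Lemma mellin_int_lty s : 0 < s -> (mellin_int s < +oo)%E.
Proof.
move=> s0; pose C := 1 + (2 * (2 * s)) `^ (2 * s).
have C0 : 1 <= C by rewrite lerDl powR_ge0.
pose h x := expR (s * - `|x|).
have ch : continuous h.
  move=> x; apply: (@continuous_comp _ _ _ (fun x => - `|x|) (fun x => expR (s * x))).
    by apply: cvgN; exact: norm_continuous.
  exact: continuous_expRM.
have mh : measurable_fun setT h by exact: continuous_measurable_fun.
have hE : (\int[mu]_x (h x)%:E < +oo)%E.
  rewrite ge0_symfun_integralT//.
  - rewrite (_ : [set x | _] = `[0, +oo[%classic); last first.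
      by apply/seteqP; split => x/=; rewrite in_itv/= andbT.
    rewrite integral_mkcond.
    apply: (@le_lt_trans _ _ (2%:E * \int[mu]_x (s^-1%:E * (exponential_pdf s x)%:E))%E).
      rewrite lee_pmul2l//; apply: ge0_le_integral => //.
      + move=> x _; rewrite patchE; case: ifP => // _; exact: expR_ge0.
      + apply/(measurable_restrictT _ _).1 => //.
        by apply/measurable_EFinP/measurable_funTS.
      + apply: emeasurable_funM => //.
        by apply/measurable_EFinP; exact: measurable_exponential_pdf.
      + move=> x _; rewrite patchE -EFinM; case: ifPn => x0.
          move: x0; rewrite inE/= in_itv/= andbT => x0.
          rewrite exponential_pdfE// mulKf ?gt_eqF// /h ger0_norm// lee_fin.
          by rewrite mulrN mulNr.
        by rewrite lee_fin mulr_ge0 ?invr_ge0 ?exponential_pdf_ge0 ?ltW.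
    rewrite ge0_integralZl_EFin ?invr_ge0 ?ltW//.
    + by rewrite integral_exponential_pdf// mule1 -EFinM ltry.
    + by move=> x _; rewrite lee_fin exponential_pdf_ge0 ?ltW.
    + by apply/measurable_EFinP; exact: measurable_exponential_pdf.
  - by move=> x; exact: expR_ge0.
  - by move=> x; rewrite /h/= normrN.
apply: (@le_lt_trans _ _ (\int[mu]_x (C%:E * (h x)%:E))%E).
  apply: ge0_le_integral => //.
  - by apply/measurable_EFinP; exact: measurable_mellin.
  - by apply: emeasurable_funM => //; exact/measurable_EFinP.
  move=> x _; rewrite -EFinM lee_fin /h.
  have [x0|x0] := leP x 0.
    rewrite ler0_norm// opprK mulrC ler_wpM2r ?expR_ge0//.
    by rewrite (le_trans _ C0)// -expR0 ler_expR oppr_le0 expR_ge0.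
  rewrite gtr0_norm//.
  rewrite (_ : s * - x = s * x + - (x * (2 * s))); last by ring.
  rewrite expRD mulrCA ler_wpM2l ?expR_ge0//.
  rewrite [expR (- (x * _))]expRN ler_pdivlMr ?expR_gt0// expRM.
  have s20 : 0 < 2 * s by lra.
  rewrite (@le_trans _ _ (expR (- expR x) * ((2 * (2 * s)) `^ (2 * s) * expR (expR x / 2))))//.
    by rewrite ler_wpM2l ?expR_ge0// powR_le_expR_half ?expR_ge0.
  rewrite mulrCA -expRD (@le_trans _ _ ((2 * (2 * s)) `^ (2 * s)))//; last first.
    by rewrite lerDr.
  rewrite ler_piMr ?powR_ge0// -[leRHS]expR0 ler_expR.
  by have := expR_ge0 x; lra.
rewrite ge0_integralZl_EFin//.
- by rewrite lte_mul_pinfty// lee_fin; lra.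
- by move=> x _; rewrite lee_fin expR_ge0.
- exact/measurable_EFinP.
- by lra.
Qed.

Lemma GammaE q : 0 < q -> Gamma (q + 1) = fine (gamma_int q).
Proof.
move=> q0; rewrite /Gamma /gamma_int integral_mkcond; congr fine.
apply: eq_integral => v _; rewrite patchE addrK; case: ifPn => v0.
  by move: v0; rewrite inE/= in_itv/= andbT => v0; rewrite pospowE.
move: v0; rewrite notin_setE/= in_itv/= andbT => /negP; rewrite -ltNge => v0.
by rewrite pospow_le0 ?ltW// mul0r.
Qed.

End IntegralValues.

(** * Absolutely convergent sums *)

Section RealSums.
Set Implicit Arguments.
Unset Strict Implicit.
Context {R : realType} {T : choiceType}.
Implicit Types (f g p q : T -> R) (c : R).

(** A supremum over finite subsets, hence the sum when the terms are nonnegative; signed series go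
    through [tsum]. *)
Definition esumr f : \bar R := (\esum_(n in [set: T]) (f n)%:E)%E.

Definition summ f : Prop := (esumr (fun n => `|f n|%R) < +oo)%E.

(* Junk value when [f] is not [summ]. *)
Definition tsum f : R :=
  fine (esumr (fun n => Num.max (f n) 0)) -
  fine (esumr (fun n => Num.max (- f n) 0)).

Lemma esumr_ge0 f : (forall n, 0 <= f n) -> (0 <= esumr f)%E.
Proof. by move=> f0; apply: esum_ge0 => n _; rewrite lee_fin. Qed.

Lemma le_esumr f g : (forall n, f n <= g n) -> (esumr f <= esumr g)%E.
Proof. by move=> fg; apply: le_esum => n _; rewrite lee_fin. Qed.

Lemma esumrD f g : (forall n, 0 <= f n) -> (forall n, 0 <= g n) ->
  esumr (fun n => f n + g n) = (esumr f + esumr g)%E.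
Proof.
move=> f0 g0; rewrite /esumr -esumD; first by apply: eq_esum => n _; rewrite EFinD.
- by move=> n _; rewrite lee_fin.
- by move=> n _; rewrite lee_fin.
Qed.

Lemma summ_le f g : summ g -> (forall n, `|f n| <= g n) -> summ f.
Proof.
move=> sg fg; apply: le_lt_trans sg; apply: le_esumr => n.
by rewrite (le_trans (fg n))// ler_norm.
Qed.

Lemma esumr_lty f : summ f -> (esumr f < +oo)%E.
Proof. by apply: le_lt_trans; apply: le_esumr => n; exact: ler_norm. Qed.

Lemma summ_lty f : (forall n, 0 <= f n) -> (esumr f < +oo)%E -> summ f.
Proof.
move=> f0; apply: le_lt_trans; apply: le_esumr => n; by rewrite ger0_norm.
Qed.

Lemma esumr_fin f : (forall n, 0 <= f n) -> summ f -> esumr f \is a fin_num.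
Proof. by move=> f0 sf; rewrite ge0_fin_numE ?esumr_ge0// esumr_lty. Qed.

Lemma summD f g : summ f -> summ g -> summ (fun n => f n + g n).
Proof.
move=> sf sg; apply: (@le_lt_trans _ _ (esumr (fun n => (`|f n| + `|g n|)%R))).
  by apply: le_esumr => n; exact: ler_normD.
by rewrite esumrD// lte_add_pinfty.
Qed.

Lemma esumrZ c f : 0 <= c -> (forall n, 0 <= f n) ->
  esumr (fun n => c * f n) = (c%:E * esumr f)%E.
Proof.
move=> c0 f0; rewrite /esumr /esum -ereal_supZl//; last first.
  by apply/set0P; exists 0%E, set0; [exact: fsets_set0|rewrite fsbig_set0].
congr ereal_sup; apply/seteqP; split => x /=.
  move=> [A sA <-]; have [fA _] := sA; exists (\sum_(n \in A) (f n)%:E)%E; first by exists A.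
  rewrite !fsbig_finite//= ge0_sume_distrr//.
  by move=> n _; rewrite lee_fin.
move=> [_ [A sA <-] <-]; have [fA _] := sA; exists A => //.
rewrite !fsbig_finite//= ge0_sume_distrr//.
by move=> n _; rewrite lee_fin.
Qed.

Lemma summZ c f : summ f -> summ (fun n => c * f n).
Proof.
move=> sf; rewrite /summ (_ : (fun n => `|c * f n|) = (fun n => `|c| * `|f n|)).
  by rewrite esumrZ// lte_mul_pinfty// lee_fin.
by apply/funext => n; rewrite normrM.
Qed.

Lemma summ_norm f : summ f -> summ (fun n => `|f n|).
Proof. by rewrite /summ; under [X in _ -> (esumr X < _)%E]eq_fun do rewrite normr_id. Qed.

Lemma summN f : summ f -> summ (fun n => - f n).
Proof. by move=> sf; apply: (summ_le (summ_norm sf)) => n; rewrite normrN. Qed.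

(** The value does not depend on how the series is split into nonnegative parts: with the canonical
    parts [P] and [Q] one has [P + q = Q + p] termwise. Additivity of [tsum] rests on this. *)
Lemma tsum_sub p q : (forall n, 0 <= p n) -> (forall n, 0 <= q n) ->
  summ p -> summ q -> tsum (fun n => p n - q n) = fine (esumr p) - fine (esumr q).
Proof.
move=> p0 q0 sp sq; rewrite /tsum.
set P := fun n => Num.max (p n - q n) 0; set Q := fun n => Num.max (- (p n - q n)) 0.
have P0 n : 0 <= P n by rewrite le_max lexx orbT.
have Q0 n : 0 <= Q n by rewrite le_max lexx orbT.
have sP : summ P.
  apply: (summ_le sp) => n; rewrite ger0_norm// ge_max p0 andbT.
  by rewrite lerBlDr lerDl.
have sQ : summ Q.
  apply: (summ_le sq) => n; rewrite ger0_norm// ge_max q0 andbT.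
  by rewrite opprB lerBlDr lerDl.
have /(congr1 fine) : (esumr P + esumr q = esumr Q + esumr p)%E.
  rewrite -!esumrD//; apply: eq_esum => n _; congr EFin; rewrite /P /Q.
  by have [h|h] := leP (p n - q n) 0; [rewrite max_l|rewrite max_r]; lra.
rewrite !fineD ?esumr_fin//; lra.
Qed.

Lemma tsum_esumr f : (forall n, 0 <= f n) -> summ f -> ((tsum f)%:E = esumr f)%E.
Proof.
move=> f0 sf.
have s0 : esumr (fun=> 0 : R) = 0%E by apply: esum1.
rewrite (_ : f = fun n => f n - 0); last by apply/funext => n; rewrite subr0.
rewrite tsum_sub//; last by rewrite /summ normr0 s0 ltry.
rewrite s0 subr0 fineK//; first by congr esumr; apply/funext => n; rewrite subr0.
exact: esumr_fin.
Qed.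

Lemma summ_max0 f : summ f -> summ (fun n => Num.max (f n) 0).
Proof.
move=> sf; apply: (summ_le (summ_norm sf)) => n; rewrite ger0_norm ?le_max ?lexx ?orbT//.
by rewrite ge_max ler_norm normr_ge0.
Qed.

Let maxBN (x : R) : Num.max x 0 - Num.max (- x) 0 = x.
Proof. by have [h|h] := leP x 0; [rewrite max_l|rewrite max_r]; lra. Qed.

Lemma tsumD f g : summ f -> summ g -> tsum (fun n => f n + g n) = tsum f + tsum g.
Proof.
move=> sf sg.
pose fp n := Num.max (f n) 0; pose fm n := Num.max (- f n) 0.
pose gp n := Num.max (g n) 0; pose gm n := Num.max (- g n) 0.
have h n : [/\ 0 <= fp n, 0 <= fm n, 0 <= gp n & 0 <= gm n].
  by split; rewrite le_max lexx orbT.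
have [sfp sfm] : summ fp /\ summ fm by split; apply: summ_max0 => //; exact: summN.
have [sgp sgm] : summ gp /\ summ gm by split; apply: summ_max0 => //; exact: summN.
rewrite (_ : (fun n => f n + g n) = fun n => (fp n + gp n) - (fm n + gm n)); last first.
  apply/funext => n; rewrite -[f n]maxBN -[g n]maxBN -/(fp n) -/(gp n) -/(fm n) -/(gm n).
  by ring.
rewrite tsum_sub//; [|by move=> n; case: (h n); lra..|exact: summD|exact: summD].
rewrite !esumrD; try by move=> n; case: (h n).
rewrite !fineD; try by apply: esumr_fin => // n; case: (h n).
by rewrite /tsum -/fp -/fm -/gp -/gm; ring.
Qed.

Lemma tsumN f : tsum (fun n => - f n) = - tsum f.
Proof.
rewrite /tsum opprB; congr (_ - fine (esumr _)).
by apply/funext => n; rewrite opprK.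
Qed.

Lemma tsumZ c f : summ f -> tsum (fun n => c * f n) = c * tsum f.
Proof.
move=> sf.
wlog c0 : c / 0 <= c.
  move=> h; have [/h//|/ltW c0] := leP 0 c.
  rewrite -[c]opprK (_ : (fun n => - - c * f n) = fun n => - ((- c) * f n)).
    by rewrite tsumN h ?oppr_ge0// !mulNr.
  by apply/funext => n; rewrite mulNr.
rewrite /tsum mulrBr.
have E g : summ g -> fine (esumr (fun n => Num.max (c * g n) 0)) =
    c * fine (esumr (fun n => Num.max (g n) 0)).
  move=> sg.
  rewrite (_ : (fun n => Num.max (c * g n) 0) = fun n => c * Num.max (g n) 0).
    rewrite esumrZ//; last by move=> n; rewrite le_max lexx orbT.
    rewrite fineM//; apply: esumr_fin; last exact: summ_max0.
    by move=> n; rewrite le_max lexx orbT.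
  by apply/funext => n; rewrite maxr_pMr// mulr0.
rewrite E// -(E (fun n => - f n)); last exact: summN.
rewrite (_ : (fun n => Num.max (- (c * f n)) 0) = fun n => Num.max (c * - f n) 0)//.
by apply/funext => n; rewrite mulrN.
Qed.

Lemma tsum_ge0 f : summ f -> (forall n, 0 <= f n) -> 0 <= tsum f.
Proof. by move=> sf f0; rewrite -lee_fin tsum_esumr// esumr_ge0. Qed.

Lemma le_tsum f g : summ f -> summ g -> (forall n, f n <= g n) -> tsum f <= tsum g.
Proof.
move=> sf sg fg; rewrite -subr_ge0 -tsumN -tsumD//; last exact: summN.
apply: tsum_ge0; first by apply: summD => //; exact: summN.
by move=> n; rewrite subr_ge0.
Qed.

(** The right side may be infinite, as happens below for the eigenvalue bound at negative shifts
    [t]. *)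
Lemma tsum_le_esumr f g : summ f -> (forall n, f n <= g n) -> (forall n, 0 <= g n) ->
  ((tsum f)%:E <= esumr g)%E.
Proof.
move=> sf fg g0; have [sg|] := boolP (esumr g < +oo)%E.
  have sg' : summ g by exact: summ_lty.
  by rewrite -tsum_esumr// lee_fin le_tsum.
by rewrite -leNgt leye_eq => /eqP ->; rewrite leey.
Qed.

Lemma summ0 : summ (fun=> 0).
Proof. by rewrite /summ /esumr esum1// => n _; rewrite normr0. Qed.

Lemma tsum0 : tsum (fun=> 0) = 0.
Proof. by rewrite /tsum oppr0 subrr. Qed.

Lemma summ_sum (I : Type) (r : seq I) (F : I -> T -> R) :
  (forall i, summ (F i)) -> summ (fun n => \sum_(i <- r) F i n).
Proof.
move=> sF; elim: r => [|i r IH].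
  by under eq_fun do rewrite big_nil; exact: summ0.
by under eq_fun do rewrite big_cons; exact: summD.
Qed.

Lemma tsum_sum (I : Type) (r : seq I) (F : I -> T -> R) :
  (forall i, summ (F i)) ->
  tsum (fun n => \sum_(i <- r) F i n) = \sum_(i <- r) tsum (F i).
Proof.
move=> sF; elim: r => [|i r IH].
  by under eq_fun do rewrite big_nil; rewrite tsum0 big_nil.
under eq_fun do rewrite big_cons.
by rewrite tsumD// ?IH ?big_cons//; exact: summ_sum.
Qed.

Lemma le_term_tsum f n : summ f -> (forall n, 0 <= f n) -> f n <= tsum f.
Proof.
move=> sf f0; rewrite -lee_fin tsum_esumr//; apply: esum_ge.
by exists [set n]; rewrite ?fsbig_set1//; split.
Qed.

(** Evaluates the single term that survives the telescoping in [discrete_agmon]. *)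
Lemma tsum_supp1 n c : summ (fun k => if k == n then c else 0) /\
  tsum (fun k => if k == n then c else 0) = c.
Proof.
have E d : 0 <= d -> esumr (fun k : T => if k == n then d else 0) = d%:E.
  move=> d0; rewrite /esumr -(@esum_set1 _ _ n (fun=> d%:E)) ?lee_fin//.
  rewrite [RHS]esum_mkcond; apply: eq_esum => k _.
  by rewrite in_set1; case: ifP.
split.
  rewrite /summ (_ : (fun k => _) = fun k => if k == n then `|c| else 0).
    by rewrite E ?ltry.
  by apply/funext => k; case: ifP; rewrite ?normr0.
rewrite /tsum.
rewrite (_ : (fun k => _) = fun k => if k == n then Num.max c 0 else 0); last first.
  by apply/funext => k; case: ifP; rewrite ?maxxx.
rewrite (_ : (fun k => Num.max (- _) 0) =
  fun k => if k == n then Num.max (- c) 0 else 0); last first.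
  by apply/funext => k; case: ifP; rewrite ?oppr0 ?maxxx.
by rewrite !E ?le_max ?lexx ?orbT//= maxBN.
Qed.

Lemma esumr_reindex (e : T -> T) f : bijective e ->
  esumr (fun n => f (e n)) = esumr f.
Proof.
move=> [e' eK e'K]; symmetry.
apply: (@reindex_esum _ _ _ setT setT e (fun n => (f n)%:E)).
split => //; first by move=> x y _ _; exact: (can_inj eK).
by move=> x _; exists (e' x).
Qed.

Lemma summ_reindex (e : T -> T) f : bijective e -> summ f -> summ (fun n => f (e n)).
Proof. by move=> be sf; rewrite /summ (esumr_reindex (fun n => `|f n|) be). Qed.

Lemma tsum_reindex (e : T -> T) f : bijective e -> tsum (fun n => f (e n)) = tsum f.
Proof.
move=> be; rewrite /tsum (esumr_reindex (fun n => Num.max (f n) 0) be).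
by rewrite (esumr_reindex (fun n => Num.max (- f n) 0) be).
Qed.

Lemma summM f g : summ (fun n => f n ^+ 2) -> summ (fun n => g n ^+ 2) ->
  summ (fun n => f n * g n).
Proof.
move=> sf sg; apply: (summ_le (summD sf sg)) => n.
rewrite ler_norml; have := sqr_ge0 (f n + g n); have := sqr_ge0 (f n - g n).
by have := sqr_ge0 (f n); have := sqr_ge0 (g n); nra.
Qed.

Lemma summ_sqrD f g : summ (fun n => f n ^+ 2) -> summ (fun n => g n ^+ 2) ->
  summ (fun n => (f n + g n) ^+ 2).
Proof.
move=> sf sg; apply: (summ_le (summD (summZ 2 sf) (summZ 2 sg))) => n.
by rewrite ger0_norm ?sqr_ge0//; have := sqr_ge0 (f n - g n); nra.
Qed.

Lemma summ_sqrZ c f : summ (fun n => f n ^+ 2) -> summ (fun n => (c * f n) ^+ 2).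
Proof. by move=> sf; under eq_fun do rewrite exprMn; exact: summZ. Qed.

Lemma summ_sqr_sum (I : Type) (r : seq I) (F : I -> T -> R) :
  (forall i, summ (fun n => F i n ^+ 2)) ->
  summ (fun n => (\sum_(i <- r) F i n) ^+ 2).
Proof.
move=> sF; elim: r => [|i r IH].
  by under eq_fun do rewrite big_nil expr0n/=; exact: summ0.
by under eq_fun do rewrite big_cons; exact: summ_sqrD.
Qed.

End RealSums.

(** * Discrete Sobolev inequality and Jacobi forms *)

Section JacobiForms.
Set Implicit Arguments.
Unset Strict Implicit.
Context {R : realType}.
Implicit Types (a b u v w : int -> R) (E t : R).

Lemma tsum_sqr_lincomb (T : choiceType) (I : finType) (c : I -> R) (F : I -> T -> R) :
  (forall i, summ (fun k => F i k ^+ 2)) ->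
  tsum (fun k => (\sum_i c i * F i k) ^+ 2) =
  \sum_i \sum_j c i * c j * tsum (fun k => F i k * F j k).
Proof.
move=> sF.
have sFF i j : summ (fun k => F i k * F j k) by exact: summM.
transitivity (tsum (fun k => \sum_i \sum_j c i * c j * (F i k * F j k))).
  congr tsum; apply/funext => k; rewrite expr2 big_distrlr/=.
  by apply: eq_bigr => i _; apply: eq_bigr => j _; ring.
rewrite tsum_sum; last by move=> i; apply: summ_sum => j; exact: summZ.
apply: eq_bigr => i _; rewrite tsum_sum; last by move=> j; exact: summZ.
by apply: eq_bigr => j _; rewrite tsumZ.
Qed.

Lemma bij_addz (m : int) : bijective (fun n : int => n + m).
Proof. by exists (fun n => n - m) => n; rewrite ?addrK ?subrK. Qed.

Lemma summ_shift (m : int) u : summ u -> summ (fun n => u (n + m)).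
Proof. exact/summ_reindex/bij_addz. Qed.

Lemma tsum_shift (m : int) u : tsum (fun n => u (n + m)) = tsum u.
Proof. exact/tsum_reindex/bij_addz. Qed.

Lemma summ_bounded (c : int -> R) (C : R) u : (forall n, `|c n| <= C) ->
  summ u -> summ (fun n => c n * u n).
Proof.
move=> cC /summ_norm/(summZ C) sf; apply: (summ_le sf) => n.
by rewrite normrM ler_wpM2r.
Qed.

Definition fdiff u : int -> R := fun n => u (n + 1) - u n.

Lemma summ_sqr_fdiff u : summ (fun n => u n ^+ 2) -> summ (fun n => fdiff u n ^+ 2).
Proof.
move=> su; apply: summ_sqrD; first exact: (summ_shift 1 su).
by under eq_fun do rewrite sqrrN.
Qed.

(* The telescoping identity [2 u(n)^2 = sum_k sgn(n - k) (u(k+1)^2 - u(k)^2)]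
   followed by AM-GM with parameter [l]. *)
Lemma discrete_agmon u n (l : R) : 0 < l -> summ (fun k => u k ^+ 2) ->
  4 * u n ^+ 2 <= l * tsum (fun k => fdiff u k ^+ 2) + 4 / l * tsum (fun k => u k ^+ 2).
Proof.
move=> l0 su.
(* The sign jumps between [n - 1] and [n]; after one series is shifted by an index, everything
   cancels except the term at [n], with weight [1 - (-1) = 2]. *)
pose s (k : int) : R := if (k < n)%R then 1 else -1.
have s1 k : `|s k| <= 1 by rewrite /s; case: ifP; rewrite ?normrN normr1.
have su1 : summ (fun k => u (k + 1) ^+ 2) := summ_shift 1 su.
have sd := summ_sqr_fdiff su.
have ssu1 : summ (fun k => s k * u (k + 1) ^+ 2) by exact: (summ_bounded s1).
have ssu : summ (fun k => s k * u k ^+ 2) by exact: (summ_bounded s1).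
have E2 : 2 * u n ^+ 2 = tsum (fun k => s k * u (k + 1) ^+ 2 - s k * u k ^+ 2).
  rewrite tsumD//; last exact: summN.
  rewrite tsumN -(tsum_shift (-1) (fun k => s k * u (k + 1) ^+ 2)) -tsumN -tsumD.
  - rewrite -[LHS](tsum_supp1 n (2 * u n ^+ 2)).2; congr tsum; apply/funext => k.
    rewrite subrK /s; have [kn|kn|->] := ltgtP k n.
    + by rewrite (_ : k - 1 < n); [ring|lia].
    + by rewrite (_ : (k - 1 < n) = false); [ring|lia].
    + by rewrite ltrBlDr ltrDl ltr01; ring.
  - exact: (summ_shift (-1) ssu1).
  - exact: summN.
have : 2 * u n ^+ 2 <= tsum (fun k => l / 2 * fdiff u k ^+ 2 +
    (l^-1 * u (k + 1) ^+ 2 + l^-1 * u k ^+ 2)).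
  rewrite E2; apply: le_tsum.
  - by apply: summD => //; exact: summN.
  - exact: summD (summZ _ sd) (summD (summZ _ su1) (summZ _ su)).
  - move=> k; rewrite -mulrBr.
    (* Factor the difference of squares, expand [(l D u - e (u(k+1) + u(k)))^2 >= 0] divided by [l],
       and use [(x + y)^2 <= 2 x^2 + 2 y^2]. *)
    have h (e : R) : e ^+ 2 = 1 -> e * (u (k + 1) ^+ 2 - u k ^+ 2) <=
        l / 2 * fdiff u k ^+ 2 + (l^-1 * u (k + 1) ^+ 2 + l^-1 * u k ^+ 2).
      move=> e1; have li0 : 0 < l^-1 by rewrite invr_gt0.
      have ll : l * l^-1 = 1 by rewrite mulfV// gt_eqF.
      have := mulr_ge0 (ltW li0)
        (sqr_ge0 (l * fdiff u k - e * (u (k + 1) + u k))).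
      have -> : l^-1 * (l * fdiff u k - e * (u (k + 1) + u k)) ^+ 2 =
        (l * l^-1) * l * fdiff u k ^+ 2
        - 2 * (l * l^-1) * e * (u (k + 1) ^+ 2 - u k ^+ 2)
        + e ^+ 2 * l^-1 * (u (k + 1) + u k) ^+ 2 by rewrite /fdiff; ring.
      rewrite ll e1.
      have := mulr_ge0 (ltW li0) (sqr_ge0 (u (k + 1) - u k)).
      by rewrite /fdiff; nra.
    by apply: h; rewrite /s; case: ifP => _; ring.
rewrite tsumD; [|exact: summZ|by apply: summD; exact: summZ].
rewrite tsumD; [|exact: summZ|exact: summZ].
rewrite !tsumZ// (tsum_shift 1 (fun k => u k ^+ 2)).
by move: (tsum _) (tsum _) (l^-1) => x y z; nra.
Qed.

(** * Density and kinetic energy of orthonormal families *)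

Section Orthonormal.
Variables (I : finType) (u : I -> int -> R).
Hypothesis su : forall i, summ (fun n => u i n ^+ 2).
Hypothesis ou : forall i j, tsum (fun n => u i n * u j n) = (i == j)%:R.

Let rho n := \sum_i u i n ^+ 2.
Let G i j := tsum (fun n => fdiff (u i) n * fdiff (u j) n).
(** The kinetic energy of [phi = sum_i u_i(n) u_i]. *)
Let Q n := \sum_i \sum_j u i n * u j n * G i j.

(* Eden-Foias: [discrete_agmon] at the point [n], for the projection
   [sum_i u_i(n) u_i] of the Dirac mass at [n], with [l = 2 / rho n]. *)
Lemma orthonormal_density_cube n : rho n ^+ 3 <= Q n.
Proof.
pose phi k := \sum_i u i n * u i k.
have rho_ge0 : 0 <= rho n by apply: sumr_ge0 => i _; exact: sqr_ge0.
have phin : phi n = rho n by apply: eq_bigr => i _; rewrite expr2.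
have sphi : summ (fun k => phi k ^+ 2).
  by apply: summ_sqr_sum => i; exact: summ_sqrZ.
(* By orthonormality [|phi|^2] equals [phi(n)], as for any projection of a Dirac mass. *)
have phi2 : tsum (fun k => phi k ^+ 2) = rho n.
  rewrite tsum_sqr_lincomb//; apply: eq_bigr => i _.
  rewrite (bigD1 i)//= ou eqxx mulr1 big1 ?addr0 ?expr2// => j ji.
  by rewrite ou eq_sym (negbTE ji) mulr0.
have dphi2 : tsum (fun k => fdiff phi k ^+ 2) = Q n.
  rewrite (_ : (fun k => _) = fun k => (\sum_i u i n * fdiff (u i) k) ^+ 2).
    by rewrite tsum_sqr_lincomb// => i; exact: summ_sqr_fdiff.
  apply/funext => k; congr (_ ^+ 2).
  by rewrite /fdiff -sumrB; apply: eq_bigr => i _; rewrite mulrBr.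
have Q0 : 0 <= Q n.
  by rewrite -dphi2; apply: tsum_ge0 => [|k]; [exact: summ_sqr_fdiff|exact: sqr_ge0].
move: rho_ge0; rewrite le_eqVlt => /predU1P[<-|r0]; first by rewrite expr0n.
(* This [l] is optimal in the case of equality [rho^3 = Q]. It gives
   [4 rho^2 <= 2 Q / rho + 2 rho^2], and multiplying by [rho] finishes. *)
have := @discrete_agmon phi n (2 / rho n) _ sphi; rewrite phi2 dphi2 phin.
have r1 : rho n * (rho n)^-1 = 1 by rewrite mulfV// gt_eqF.
move=> /(_ (divr_gt0 (ltr0Sn _ 1) r0)); rewrite invf_div => h.
have : rho n * (4 * rho n ^+ 2) <= rho n * (2 / rho n * Q n + 4 * (rho n / 2) * rho n).
  by rewrite ler_pM2l.
have -> : rho n * (2 / rho n * Q n + 4 * (rho n / 2) * rho n) =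
  2 * (rho n * (rho n)^-1) * Q n + 2 * rho n ^+ 3 by field; rewrite gt_eqF.
by rewrite r1; nra.
Qed.

(** Summing over [n] replaces [u_i(n) u_j(n)] by the Kronecker delta, so only the trace of [G]
    survives. *)
Lemma tsum_orthonormal_kinetic :
  summ Q /\ tsum Q = \sum_i G i i.
Proof.
have s i j : summ (fun n => u i n * u j n) by exact: summM.
have QE : Q = fun n => \sum_i \sum_j G i j * (u i n * u j n).
  by apply/funext => n; apply: eq_bigr => i _; apply: eq_bigr => j _; rewrite mulrC.
split.
  by rewrite QE; apply: summ_sum => i; apply: summ_sum => j; exact: summZ.
rewrite QE tsum_sum; last by move=> i; apply: summ_sum => j; exact: summZ.
apply: eq_bigr => i _; rewrite tsum_sum; last by move=> j; exact: summZ.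
rewrite (bigD1 i)//= tsumZ// ou eqxx mulr1 big1 ?addr0// => j ji.
by rewrite tsumZ// ou eq_sym (negbTE ji) mulr0.
Qed.

Lemma tsum_orthonormal_density : summ rho /\ tsum rho = #|I|%:R.
Proof.
split; first exact: summ_sum.
rewrite tsum_sum// (eq_bigr (fun=> 1)) ?sumr_const// => i _.
by have := ou i i; rewrite eqxx.
Qed.

End Orthonormal.

(* [x r - r^3] is maximal at [r = sqrt (x / 3)]. *)
Lemma cubic_legendre (x r : R) : 0 <= r -> x * r - r ^+ 3 <= 2 * pospow (3 / 2) (x / 3).
Proof.
move=> r0; rewrite pospow_3half; set m := Num.max (x / 3) 0.
have xm : x <= 3 * m.
  have : x / 3 <= m by rewrite le_max lexx.
  by lra.
have m0 : 0 <= m by rewrite le_max lexx orbT.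
set y := Num.sqrt m.
have y0 : 0 <= y by exact: sqrtr_ge0.
have <- : y ^+ 2 = m by rewrite sqr_sqrtr.
have xm' : x <= 3 * y ^+ 2 by rewrite sqr_sqrtr.
have h1 : x * r <= 3 * y ^+ 2 * r by rewrite ler_wpM2r.
(* Expanded, this reads [3 y^2 r - r^3 <= 2 y^3]. *)
have h2 : 0 <= (r - y) ^+ 2 * (r + 2 * y).
  by rewrite mulr_ge0 ?sqr_ge0// addr_ge0// mulr_ge0.
nra.
Qed.

(** * Quadratic forms and eigenvalues of Jacobi operators *)

Section Jacobi.
Variables (a b : int -> R) (C : R).
Hypothesis aC : forall n, `|a n| <= C.
Hypothesis bC : forall n, `|b n| <= C.

Let A u v := tsum (fun n => a n * (u n * v (n + 1))).

(** Shifting the [a (n - 1)] term by one index turns it into [A u v], which makes the symmetry in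
    [u] and [v] visible. *)
Lemma jacobi_form u v : summ (fun n => u n ^+ 2) -> summ (fun n => v n ^+ 2) ->
  tsum (fun n => jacobi a b u n * v n) = A u v + tsum (fun n => b n * (u n * v n)) + A v u.
Proof.
move=> su sv.
have sA w z : summ (fun n => w n ^+ 2) -> summ (fun n => z n ^+ 2) ->
    summ (fun n => a n * (w n * z (n + 1))).
  by move=> sw sz; apply: (summ_bounded aC); apply: summM => //; exact: (summ_shift 1 sz).
have sB : summ (fun n => b n * (u n * v n)).
  by apply: (summ_bounded bC); exact: summM.
have sA' : summ (fun n => a (n - 1) * (u (n - 1) * v (n - 1 + 1))).
  exact: (summ_shift (-1) (sA _ _ su sv)).
rewrite /A -(tsum_shift (-1) (fun n => a n * (u n * v (n + 1)))).
rewrite -tsumD// -tsumD//; [|exact: summD|exact: sA].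
by congr tsum; apply/funext => n; rewrite /jacobi subrK; ring.
Qed.

Lemma eigenvectors_orthogonal u v E E' :
  summ (fun n => u n ^+ 2) -> summ (fun n => v n ^+ 2) ->
  (forall n, jacobi a b u n = E * u n) -> (forall n, jacobi a b v n = E' * v n) ->
  E != E' -> tsum (fun n => u n * v n) = 0.
Proof.
move=> su sv uE vE EE'.
have h1 : E * tsum (fun n => u n * v n) = tsum (fun n => jacobi a b u n * v n).
  rewrite -tsumZ; last exact: summM.
  by congr tsum; apply/funext => n; rewrite uE mulrA.
have h2 : E' * tsum (fun n => u n * v n) = tsum (fun n => jacobi a b v n * u n).
  rewrite -tsumZ; last exact: summM.
  by congr tsum; apply/funext => n; rewrite vE; ring.
have : (E - E') * tsum (fun n => u n * v n) = 0.
  rewrite mulrBl h1 h2 !jacobi_form//.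
  rewrite (_ : (fun n => b n * (u n * v n)) = fun n => b n * (v n * u n)); first by ring.
  by apply/funext => n; rewrite (mulrC (u n)).
by move/eqP; rewrite mulf_eq0 subr_eq0 (negbTE EE')/= => /eqP.
Qed.

(* By AM-GM [2 (a_n - 1) u_n u_(n+1)] is at most [|a_n - 1| (u_n^2 + u_(n+1)^2)],
   so the Jacobi operator is dominated by the discrete Schroedinger operator with
   this potential. *)
Definition potential n := Num.max (b n) 0 + `|a n - 1| + `|a (n - 1) - 1|.

Lemma potential_bounded : exists K, forall n, `|potential n| <= K.
Proof.
exists (C + (C + 1) + (C + 1)) => n.
have h m : `|a m - 1| <= C + 1.
  by rewrite (le_trans (ler_normB _ _))// normr1 lerD2r.
have bn : Num.max (b n) 0 <= C.
  rewrite ge_max (le_trans (ler_norm _) (bC n))/=.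
  exact: le_trans (bC n).
rewrite ger0_norm ?addr_ge0 ?le_max ?lexx ?orbT//.
by rewrite !lerD.
Qed.

(** The free part satisfies [2 u_n u_(n+1) = u_n^2 + u_(n+1)^2 - (D u)_n^2], which sums to
    [2 - |D u|^2]. The remainder is bounded termwise, and an index shift of its [u_(n+1)^2] part
    produces the weight [|a (n - 1) - 1|]. *)
Lemma eigenvalue_le u E : summ (fun n => u n ^+ 2) -> tsum (fun n => u n ^+ 2) = 1 ->
  (forall n, jacobi a b u n = E * u n) ->
  E - 2 <= tsum (fun n => potential n * u n ^+ 2) - tsum (fun n => fdiff u n ^+ 2).
Proof.
move=> su u1 uE.
have su1 : summ (fun n => u (n + 1) ^+ 2) := summ_shift 1 su.
have sd := summ_sqr_fdiff su.
have sA : summ (fun n => a n * (u n * u (n + 1))).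
  by apply: (summ_bounded aC); exact: summM.
have sB : summ (fun n => b n * (u n * u n)).
  by apply: (summ_bounded bC); exact: summM.
have a1C m : `| `|a m - 1| | <= C + 1.
  by rewrite normr_id (le_trans (ler_normB _ _))// normr1 lerD2r.
have bpC m : `|Num.max (b m) 0| <= C.
  rewrite ger0_norm ?le_max ?lexx ?orbT// ge_max (le_trans (ler_norm _) (bC m))/=.
  exact: le_trans (bC m).
have s1 : summ (fun n => `|a n - 1| * u n ^+ 2) by exact: (summ_bounded a1C).
have s2 : summ (fun n => `|a n - 1| * u (n + 1) ^+ 2) by exact: (summ_bounded a1C).
have s2' : summ (fun n => `|a (n - 1) - 1| * u n ^+ 2).
  by apply: (summ_bounded (fun n => a1C (n - 1))).
have s3 : summ (fun n => Num.max (b n) 0 * u n ^+ 2) by exact: (summ_bounded bpC).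
have E1 : E = tsum (fun n => 2 * (a n * (u n * u (n + 1))) + b n * (u n * u n)).
  rewrite tsumD//; last exact: summZ.
  rewrite tsumZ//.
  have := jacobi_form su su; rewrite /A.
  rewrite (_ : (fun n => jacobi a b u n * u n) = fun n => E * u n ^+ 2); last first.
    by apply/funext => n; rewrite uE; ring.
  by rewrite tsumZ// u1 mulr1 => ->; ring.
have r5 := summD s2 s3.
have r4 := summD s1 r5.
have r3 := summD (summZ (-1) sd) r4.
have r2 := summD su1 r3.
have sR : summ (fun n => u n ^+ 2 + (u (n + 1) ^+ 2 + ((-1) * fdiff u n ^+ 2 +
  (`|a n - 1| * u n ^+ 2 + (`|a n - 1| * u (n + 1) ^+ 2 + Num.max (b n) 0 * u n ^+ 2))))).
  exact: summD su r2.
have : E <= tsum (fun n => u n ^+ 2 + (u (n + 1) ^+ 2 + ((-1) * fdiff u n ^+ 2 +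
  (`|a n - 1| * u n ^+ 2 + (`|a n - 1| * u (n + 1) ^+ 2 + Num.max (b n) 0 * u n ^+ 2))))).
  rewrite {1}E1; apply: le_tsum => //.
    by apply: summD => //; exact: summZ.
  move=> n.
  have hb : b n * (u n * u n) <= Num.max (b n) 0 * u n ^+ 2.
    by rewrite expr2 ler_wpM2r ?le_max ?lexx// -expr2 sqr_ge0.
  have h1 : (a n - 1) * (2 * (u n * u (n + 1))) <=
      `|a n - 1| * u n ^+ 2 + `|a n - 1| * u (n + 1) ^+ 2.
    rewrite -mulrDr (le_trans (ler_norm _))// normrM ler_wpM2l// ler_norml.
    by have := sqr_ge0 (u n - u (n + 1)); have := sqr_ge0 (u n + u (n + 1)); nra.
  by rewrite /fdiff; nra.
rewrite (tsumD su r2) (tsumD su1 r3) (tsumD (summZ (-1) sd) r4) (tsumD s1 r5).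
rewrite (tsumD s2 s3) tsumZ// (tsum_shift 1 (fun n => u n ^+ 2)) u1.
rewrite -(tsum_shift (-1) (fun n => `|a n - 1| * u (n + 1) ^+ 2)).
rewrite (_ : (fun n => `|a (n - 1) - 1| * u (n - 1 + 1) ^+ 2) =
  fun n => `|a (n - 1) - 1| * u n ^+ 2); last by apply/funext => n; rewrite subrK.
rewrite (_ : (fun n => potential n * u n ^+ 2) = fun n => Num.max (b n) 0 * u n ^+ 2 +
  (`|a n - 1| * u n ^+ 2 + `|a (n - 1) - 1| * u n ^+ 2)); last first.
  by apply/funext => n; rewrite /potential; ring.
rewrite tsumD//; last exact: summD.
by rewrite tsumD//; lra.
Qed.

(** Summing [eigenvalue_le] over normalized eigenvectors leaves [(V - t) rho - Q] on the right,
    since [rho] sums to the number of vectors; [Q >= rho^3] and [cubic_legendre] then apply at each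
    site. *)
Lemma eigenvalue_sum_le (I : finType) (E : I -> R) t :
  injective E -> (forall i, jacobi_eigenvalue a b (E i)) ->
  ((\sum_i (E i - 2 - t))%:E <=
    esumr (fun n => 2 * pospow (3 / 2) ((potential n - t) / 3))%R)%E.
Proof.
move=> injE eigE.
have /choice[u hu] : forall i, exists w : int -> R, [/\ summ (fun n => w n ^+ 2),
    tsum (fun n => w n ^+ 2) = 1 & forall n, jacobi a b w n = E i * w n].
  move=> i; have [w [lw [w0 wE]]] := eigE i.
  have sw : summ (fun n => w n ^+ 2).
    apply: summ_lty => [n|]; first exact: sqr_ge0.
    move: lw; rewrite /in_lp /lp_sum.
    by under eq_esum do rewrite powR_mulrn// real_normK ?num_real//.
  have nw : 0 < tsum (fun n => w n ^+ 2).
    rewrite lt_neqAle tsum_ge0 ?andbT//; last by move=> n; exact: sqr_ge0.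
    apply/eqP => h; apply: w0; apply/funext => n.
    have := le_term_tsum n sw (fun n => sqr_ge0 (w n)); rewrite -h => hn.
    by apply/eqP; rewrite -sqrf_eq0 eq_le hn sqr_ge0.
  pose c := (Num.sqrt (tsum (fun n => w n ^+ 2)))^-1.
  exists (fun n => c * w n); split.
  - exact: summ_sqrZ.
  - rewrite (_ : (fun n => (c * w n) ^+ 2) = fun n => c ^+ 2 * w n ^+ 2).
      by rewrite tsumZ// exprVn sqr_sqrtr ?ltW// mulVf// gt_eqF.
    by apply/funext => n; rewrite exprMn.
  - by move=> n; rewrite mulrCA -wE /jacobi; ring.
have su i : summ (fun n => u i n ^+ 2) by case: (hu i).
have uE i : forall n, jacobi a b (u i) n = E i * u i n by case: (hu i).
have ou i j : tsum (fun n => u i n * u j n) = (i == j)%:R.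
  have [->|ij] := eqVneq i j; first by case: (hu j).
  apply: (eigenvectors_orthogonal (su i) (su j) (uE i) (uE j)).
  by apply: contra ij => /eqP/injE ->.
pose rho n := \sum_i u i n ^+ 2.
pose G i j := tsum (fun n => fdiff (u i) n * fdiff (u j) n).
pose Q n := \sum_i \sum_j u i n * u j n * G i j.
have [sQ QE] : summ Q /\ tsum Q = \sum_i G i i := tsum_orthonormal_kinetic su ou.
have [srho rhoE] : summ rho /\ tsum rho = #|I|%:R := tsum_orthonormal_density su ou.
have [K VK] := potential_bounded.
have sVr : summ (fun n => potential n * rho n) by exact: (summ_bounded VK).
have VrE : tsum (fun n => potential n * rho n) =
    \sum_i tsum (fun n => potential n * u i n ^+ 2).
  rewrite -tsum_sum => [|i]; last exact: (summ_bounded VK).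
  by congr tsum; apply/funext => n; rewrite mulr_sumr.
have h : \sum_i (E i - 2 - t) <=
    tsum (fun n => potential n * rho n + (- t * rho n + - Q n)).
  have sN : summ (fun n => - t * rho n + - Q n).
    by apply: summD; [exact: summZ|exact: summN].
  rewrite tsumD// tsumD ?tsumN ?tsumZ ?rhoE ?QE ?VrE//; first last.
  - exact: summN.
  - exact: summZ.
  have -> : \sum_i (E i - 2 - t) = \sum_i (E i - 2) - t * #|I|%:R.
    by rewrite sumrB sumr_const mulr_natr.
  have : \sum_i (E i - 2) <=
      \sum_i tsum (fun n => potential n * u i n ^+ 2) - \sum_i G i i.
    rewrite -sumrB; apply: ler_sum => i _; case: (hu i) => _ u1 _.
    apply: le_trans (eigenvalue_le (su i) u1 (uE i)) _.
    by rewrite lerD2l lerN2.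
  by lra.
move: h; rewrite -lee_fin => h; apply: (le_trans h).
apply: tsum_le_esumr.
- exact: summD sVr (summD (summZ _ srho) (summN sQ)).
- move=> n; have r0 : 0 <= rho n by apply: sumr_ge0 => i _; exact: sqr_ge0.
  have := cubic_legendre (potential n - t) r0.
  have : rho n ^+ 3 <= Q n by exact: orthonormal_density_cube.
  lra.
- by move=> n; rewrite mulr_ge0 ?pospow_ge0.
Qed.

End Jacobi.
End JacobiForms.

(** * Lifting to higher moments *)

Section AizenmanLieb.
Set Implicit Arguments.
Unset Strict Implicit.
Context {R : realType}.
Local Notation mu := (@lebesgue_measure R).

(** The enumeration [0, -1, 1, -2, ...], which turns sums over the integers into series that can be
    exchanged with an integral. *)
Definition int_of_nat (n : nat) : int := if odd n then Negz n./2 else Posz n./2.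

Lemma esumr_nneseries (f : int -> R) : (forall n, 0 <= f n) ->
  esumr f = (\sum_(i <oo) (f (int_of_nat i))%:E)%E.
Proof.
move=> f0; rewrite nneseries_esumT; last by move=> i; rewrite lee_fin.
apply: (@reindex_esum _ _ _ setT setT int_of_nat (fun n => (f n)%:E)).
split => //.
  move=> m n _ _; rewrite /int_of_nat.
  case: ifPn => om; case: ifPn => on //= -[] h;
    rewrite -[m]odd_double_half -[n]odd_double_half h.
    by rewrite om on.
  by rewrite (negbTE om) (negbTE on).
move=> [n|n] _ /=.
  by exists n.*2 => //; rewrite /int_of_nat odd_double doubleK.
by exists n.*2.+1 => //; rewrite /int_of_nat /= odd_double/= uphalf_double.
Qed.

(* [Mel s] is [Gamma s], finite and positive, so that it can be cancelled in
   [lieb_thirring_seq]. *)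
Lemma gamma_beta_values : exists Gam Mel : R -> R,
  [/\ forall q, 0 < q -> 0 < Gam q /\ Gamma (q + 1) = Gam q,
      4 / 3 * Gam (3 / 2) = Num.sqrt pi * Gam 1,
      forall s, 0 < s -> 0 < Mel s &
      forall s q, 0 < s -> 0 < q -> continuous (pospow q) ->
        beta_int s q = (Mel s * (Gam q / Gam (s + q)))%:E].
Proof.
have [Gam GE] : exists Gam : R -> R, forall q, 0 < q ->
    [/\ gamma_int q = (Gam q)%:E, 0 < Gam q & Gamma (q + 1) = Gam q].
  exists (fun q => fine (gamma_int q)) => q q0; split; last exact: GammaE.
  - rewrite fineK// ge0_fin_numE; first exact: gamma_int_lty.
    exact/ltW/gamma_int_gt0.
  - by apply: fine_gt0; rewrite gamma_int_gt0//=; exact: gamma_int_lty.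
have [Mel ME] : exists Mel : R -> R, forall s, 0 < s ->
    mellin_int s = (Mel s)%:E /\ 0 < Mel s.
  exists (fun s => fine (mellin_int s)) => s s0; split.
  - rewrite fineK// ge0_fin_numE; first exact: mellin_int_lty.
    exact/ltW/mellin_int_gt0.
  - by apply: fine_gt0; rewrite mellin_int_gt0/=; exact: mellin_int_lty.
exists Gam, Mel; split.
- by move=> q /GE[_ ? ?].
- have h32 : 0 < (3 / 2 : R) by lra.
  have := @gamma_int_3half R.
  by case: (GE _ h32) (GE _ ltr01) => -> _ _ [-> _ _] [].
- by move=> s /ME[].
move=> s q s0 q0 cq.
have b0 : (0 <= beta_int s q)%E.
  by apply: integral_ge0 => x _; rewrite lee_fin mulr_ge0 ?pospow_ge0 ?expR_ge0.
have := beta_gamma s0 q0 cq; move: (beta_int s q) b0 => B B0.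
have [-> _ _] := GE _ q0; have [-> gsq _] := GE _ (addr_gt0 s0 q0).
(* Finiteness of the Beta integral comes from the identity itself: an infinite [B] times a positive
   Gamma value would be infinite, while the other side is finite. *)
have [-> _] := ME _ s0; case: B B0 => [b|_|] //.
  move=> _ [] h; congr EFin; rewrite mulrA -h mulfK// gt_eqF//.
by rewrite gt0_mulye// lte_fin.
Qed.

(* Put [t = e^x] in the hypothesis, multiply by [e^(s x)] and integrate. *)
Lemma aizenman_lieb (r : seq R) (V : int -> R) (s k b1 b2 : R) : 0 < s -> 0 <= k ->
  beta_int s 1 = b1%:E -> beta_int s (3 / 2) = b2%:E ->
  (forall t, ((\sum_(E <- r) pospow 1 (E - t))%:E <=
    esumr (fun n => k * pospow (3 / 2) (V n - t))%R)%E) ->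
  ((b1 * \sum_(E <- r) pospow (s + 1) E)%:E <=
    (k * b2)%:E * esumr (fun n => pospow (s + 3 / 2) (V n))%R)%E.
Proof.
move=> s0 k0 b1E b2E H.
have b20 : 0 <= b2.
  rewrite -lee_fin -b2E; apply: integral_ge0 => x _.
  by rewrite lee_fin mulr_ge0 ?pospow_ge0 ?expR_ge0.
have c1 := @continuous_pospow1 R.
have c2 := @continuous_pospow_3half R.
have h32 : 0 < (3 / 2 : R) by lra.
pose F (E x : R) := expR (s * x) * pospow 1 (E - expR x).
pose G (n : int) (x : R) := k * (expR (s * x) * pospow (3 / 2) (V n - expR x)).
have F0 E x : 0 <= F E x by rewrite mulr_ge0 ?pospow_ge0 ?expR_ge0.
have G0 n x : 0 <= G n x by rewrite !mulr_ge0 ?pospow_ge0 ?expR_ge0.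
have mF E : measurable_fun setT (fun x => (F E x)%:E).
  by apply/measurable_EFinP; exact: measurable_beta.
have mG n : measurable_fun setT (fun x => (G n x)%:E).
  by apply/measurable_EFinP/measurable_funM => //; exact: measurable_beta.
(* By [beta_int_scale] each [E] contributes [B(s, 2) E_+^(s + 1)], and in the next step each site
   contributes [k B(s, 5/2) V_+^(s + 3/2)]. *)
have -> : (b1 * \sum_(E <- r) pospow (s + 1) E)%:E =
    (\int[mu]_x \sum_(E <- r) (F E x)%:E)%E.
  rewrite ge0_integral_sum//; last by move=> E x _; rewrite lee_fin.
  rewrite mulr_sumr -sumEFin; apply: eq_bigr => E _.
  by rewrite beta_int_scale// b1E -EFinM mulrC.
have -> : ((k * b2)%:E * esumr (fun n => pospow (s + 3 / 2) (V n))%R =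
    \int[mu]_x \sum_(i <oo) (G (int_of_nat i) x)%:E)%E.
  rewrite integral_nneseries//; last 2 first.
  - by move=> n; exact: mG.
  - by move=> n x _; rewrite lee_fin.
  rewrite -esumrZ ?mulr_ge0//; last by move=> n; exact: pospow_ge0.
  rewrite esumr_nneseries; last by move=> n; rewrite !mulr_ge0 ?pospow_ge0.
  apply: eq_eseriesr => i _; rewrite /G.
  transitivity (k%:E * \int[mu]_x (expR (s * x) *
      pospow (3 / 2) (V (int_of_nat i) - expR x))%:E)%E.
    by rewrite beta_int_scale// b2E -!EFinM; congr EFin; ring.
  rewrite -ge0_integralZl_EFin//.
  - by move=> x _; rewrite lee_fin mulr_ge0 ?pospow_ge0 ?expR_ge0.
  - by apply/measurable_EFinP; exact: measurable_beta.
apply: ge0_le_integral => //.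
- by move=> x _; apply: sume_ge0 => E _; rewrite lee_fin.
- exact: emeasurable_sum.
- apply: (@ge0_emeasurable_sum _ _ _ _ _ xpredT) => [i x _ _|i _].
    by rewrite lee_fin.
  exact: mG.
move=> x _; rewrite -(@esumr_nneseries (G ^~ x))//.
have -> : (\sum_(E <- r) (F E x)%:E =
    (expR (s * x))%:E * (\sum_(E <- r) pospow 1 (E - expR x))%:E)%E.
  by rewrite sumEFin -EFinM mulr_sumr.
have -> : esumr (fun n => G n x) =
    ((expR (s * x))%:E * esumr (fun n => k * pospow (3 / 2) (V n - expR x))%R)%E.
  rewrite -esumrZ ?expR_ge0//; last by move=> n; rewrite mulr_ge0 ?pospow_ge0.
  by congr esumr; apply/funext => n; rewrite /G; ring.
by rewrite lee_wpmul2l// lee_fin expR_ge0.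
Qed.

End AizenmanLieb.

(** * The bound by the potential for finitely many eigenvalues *)

Section LiebThirring.
Set Implicit Arguments.
Unset Strict Implicit.
Context {R : realType}.
Implicit Types (a b : int -> R) (g : R).

(** The constant of the bound by [potential], before convexity contributes [3^(g - 1/2)]. *)
Definition lt_const g : R := pi / Num.sqrt 3 * Lcl g.

(** The form in which the lifting produces the constant: [2 * 3^(-3/2)] from [cubic_legendre], times
    [B(g - 1, 5/2) / B(g - 1, 2)] when [g > 1]. Here [Gam q] is Euler's Gamma at [q + 1]. *)
Lemma lt_constE (Gam : R -> R) g : 1 <= g ->
  (forall q, 0 < q -> 0 < Gam q /\ Gamma (q + 1) = Gam q) ->
  4 / 3 * Gam (3 / 2) = Num.sqrt pi * Gam 1 ->
  lt_const g = 2 * 3^-1 `^ (3 / 2) * (Gam (3 / 2) / Gam (g + 1 / 2)) *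
    (Gam g / Gam 1).
Proof.
move=> g1 GE h; rewrite /lt_const /Lcl.
rewrite (_ : g + 3 / 2 = g + 1 / 2 + 1); last by lra.
have g0 : 0 < g by lra.
have g20 : 0 < g + 1 / 2 by lra.
have [_ ->] := GE _ g0; have [n2 ->] := GE _ g20; have [n1 _] := GE _ ltr01.
have -> : Gam (3 / 2) = 3 / 4 * Num.sqrt pi * Gam 1.
  by rewrite -mulrA -h; field.
have -> : 3^-1 `^ (3 / 2) = (3 * Num.sqrt 3)^-1 :> R.
  rewrite -pospowE ?invr_ge0// pospow_3half max_l ?invr_ge0// sqrtrV// invfM//.
move: (Gam g) (Gam (g + 1 / 2)) (Gam 1) n1 n2 => A B C n1 n2.
have s3 : 0 < Num.sqrt 3 :> R by rewrite sqrtr_gt0.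
have sp : 0 < Num.sqrt pi :> R by rewrite sqrtr_gt0 pi_gt0.
rewrite -{1}(@sqr_sqrtr _ pi) ?pi_ge0//.
by move: (Num.sqrt 3) (Num.sqrt pi) s3 sp => x y s3 sp; field; rewrite !gt_eqF.
Qed.

(** [eigenvalue_sum_le] applies to any finite family of distinct eigenvalues; selecting those above
    [2 + t] turns its left side into a sum of positive parts. *)
Lemma sum_eigenvalues_shift a b (C : R) (r : seq R) (t : R) :
  (forall n, `|a n| <= C) -> (forall n, `|b n| <= C) -> uniq r ->
  (forall E, E \in r -> jacobi_eigenvalue a b E) ->
  ((\sum_(E <- r) pospow 1 (E - 2 - t))%:E <=
   esumr (fun n => 2 * 3^-1 `^ (3 / 2) * pospow (3 / 2) (potential a b n - t))%R)%E.
Proof.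
move=> aC bC ur rE; set r' := [seq E <- r | 0 < E - 2 - t].
have -> : \sum_(E <- r) pospow 1 (E - 2 - t) =
    \sum_(i < size r') (nth 0 r' i - 2 - t).
  transitivity (\sum_(E <- r') (E - 2 - t)); last by rewrite (big_nth 0) big_mkord.
  rewrite big_filter [RHS]big_mkcond; apply: eq_bigr => E _; rewrite pospow1.
  by case: ltP.
have -> : (fun n => 2 * 3^-1 `^ (3 / 2) * pospow (3 / 2) (potential a b n - t)) =
    (fun n => 2 * pospow (3 / 2) ((potential a b n - t) / 3)).
  by apply/funext => n; rewrite [_ / 3]mulrC pospowM ?invr_ge0// mulrA.
apply: (eigenvalue_sum_le aC bC).
- move=> i j /eqP; rewrite nth_uniq ?filter_uniq// => /eqP; exact: val_inj.
- by move=> i; apply: rE; have := mem_nth 0 (ltn_ord i); rewrite mem_filter => /andP[].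
Qed.

(** For [g = 1] this is the shifted bound at [t = 0], both Gamma quotients being [1]. For [g > 1] it
    is lifted with [s = g - 1]. *)
Lemma lieb_thirring_seq a b (C : R) g (r : seq R) :
  (forall n, `|a n| <= C) -> (forall n, `|b n| <= C) -> 1 <= g -> uniq r ->
  (forall E, E \in r -> jacobi_eigenvalue a b E) ->
  ((\sum_(E <- r) pospow g (E - 2))%:E <=
   (lt_const g)%:E * esumr (fun n => pospow (g + 1 / 2) (potential a b n))%R)%E.
Proof.
move=> aC bC g1 ur rE.
have H t := sum_eigenvalues_shift t aC bC ur rE.
have [Gam [Mel [GE G32 M0 BE]]] := @gamma_beta_values R.
have h32 : 0 < (3 / 2 : R) by lra.
have k0 : 0 <= 2 * 3^-1 `^ (3 / 2) :> R by rewrite mulr_ge0 ?powR_ge0.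
rewrite (lt_constE g1 GE G32).
move: g1; rewrite le_eqVlt => /predU1P[<-|g1].
  have := H 0; rewrite (_ : 1 + 1 / 2 = 3 / 2); last by lra.
  have [G1 _] := GE _ ltr01; have [G3 _] := GE _ h32.
  rewrite !divff ?gt_eqF// !mulr1 -esumrZ//; last by move=> n; exact: pospow_ge0.
  by under eq_bigr do rewrite subr0; under [X in esumr X]eq_fun do rewrite subr0.
have s0 : 0 < g - 1 by lra.
have g0 : 0 < g by lra.
have g20 : 0 < g + 1 / 2 by lra.
have H' t : ((\sum_(E <- [seq E - 2 | E <- r]) pospow 1 (E - t))%:E <= esumr
    (fun n => 2 * 3^-1 `^ (3 / 2) * pospow (3 / 2) (potential a b n - t))%R)%E.
  by rewrite big_map.
have := aizenman_lieb s0 k0 (BE _ _ s0 ltr01 (@continuous_pospow1 R))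
  (BE _ _ s0 h32 (@continuous_pospow_3half R)) H'.
rewrite big_map subrK (_ : g - 1 + 3 / 2 = g + 1 / 2); last by lra.
have [G1 _] := GE _ ltr01; have [Gg _] := GE _ g0; have [Gg2 _] := GE _ g20.
have m0 := M0 _ s0.
move: (Mel _) (Gam 1) (Gam g) (Gam (g + 1 / 2)) (Gam (3 / 2)) m0 G1 Gg Gg2.
move=> m x y z w m0 x0 y0 z0.
(* This is the factor [B(g - 1, 2)] in front of the eigenvalue sum; [m] cancels against the other
   Beta value. *)
have c0 : 0 < m * (x / y) by rewrite mulr_gt0// divr_gt0.
move=> L; rewrite -(@lee_pmul2l _ (m * (x / y))%:E)//.
rewrite -EFinM (le_trans L)// muleA -EFinM.
rewrite (_ : m * (x / y) * _ = 2 * 3^-1 `^ (3 / 2) * (m * (w / z)))//.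
by field; rewrite !gt_eqF.
Qed.

End LiebThirring.

(** * Reduction to the Schroedinger case *)

Section Assembly.
Set Implicit Arguments.
Unset Strict Implicit.
Context {R : realType}.
Implicit Types (a b : int -> R) (g p : R).
Local Open Scope convex_scope.

(** Jensen's inequality for three equal weights in two binary steps: [y] and [z] are averaged first,
    then [x] gets weight [1 / 3] against their mean. *)
Lemma powR_sum3 p (x y z : R) : 1 <= p -> 0 <= x -> 0 <= y -> 0 <= z ->
  (x + y + z) `^ p <= 3 `^ (p - 1) * (x `^ p + y `^ p + z `^ p).
Proof.
move=> p1 x0 y0 z0.
have cvx (u v t : R) : 0 <= u -> 0 <= v -> 0 <= t <= 1 ->
    (t * u + (1 - t) * v) `^ p <= t * u `^ p + (1 - t) * v `^ p.
  move=> u0 v0 /andP[t0 t1].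
  by apply: (convex_powR p1 (Itv01 t0 t1)); rewrite inE/= in_itv/= andbT.
have h3 : 0 < (3 : R) by [].
have := cvx x ((y + z) / 2) 3^-1 x0.
have := cvx y z 2^-1 y0 z0.
rewrite (_ : 2^-1 * y + (1 - 2^-1) * z = (y + z) / 2); last by field.
rewrite (_ : 3^-1 * x + (1 - 3^-1) * ((y + z) / 2) = (x + y + z) / 3); last by field.
have h2 : 0 <= (2^-1 : R) <= 1 by lra.
have h3' : 0 <= (3^-1 : R) <= 1 by lra.
have yz : 0 <= (y + z) / 2 by lra.
move=> /(_ h2) A /(_ yz h3') B.
have E : (x + y + z) `^ p = 3 * 3 `^ (p - 1) * ((x + y + z) / 3) `^ p.
  rewrite mulr_powRB1 ?(lt_le_trans ltr01 p1)// -powRM//; last by lra.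
  by congr (_ `^ p); field.
rewrite E -mulrA mulrCA ler_pM2l ?powR_gt0//.
by move: A B; set X := _ `^ p; set Y := _ `^ p; lra.
Qed.

(** Supplies the bounded coefficients under which the Jacobi forms converge on square-summable
    sequences. *)
Lemma in_lp_bounded p (x : int -> R) : 0 < p -> in_lp p x ->
  exists C : R, forall n, `|x n| <= C.
Proof.
move=> p0; rewrite /in_lp /lp_sum => xp; exists (fine (esumr (fun n => `|x n| `^ p)) `^ p^-1) => n.
have h : ((`|x n| `^ p)%:E <= esumr (fun n => (`|x n| `^ p)%R))%E.
  by apply: esum_ge; exists [set n]; rewrite ?fsbig_set1//; split.
have sfin : esumr (fun n => (`|x n| `^ p)%R) \is a fin_num.
  by rewrite ge0_fin_numE//; apply: esumr_ge0 => m; exact: powR_ge0.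
move: h; rewrite -(fineK sfin) lee_fin => h.
rewrite -[leLHS](@powRr1 _ `|x n|)// -[X in _ `^ X](@mulfV _ p) ?gt_eqF//.
rewrite powRrM; apply: ge0_ler_powR => //.
- by rewrite invr_ge0 ltW.
- by rewrite nnegrE powR_ge0.
- by rewrite nnegrE (le_trans _ h)// powR_ge0.
Qed.

(** The sum over all eigenvalues is a supremum over finite sets, so the bound for lists suffices.
    The powers of [|a n - 1|] and [|a (n - 1) - 1|] have equal sums by translation, whence the
    factor [2]. *)
Lemma lieb_thirring_above a b g : 1 <= g ->
  in_lp (g + 1 / 2) b -> in_lp (g + 1 / 2) (fun n => a n - 1) ->
  (\esum_(E in [set E | jacobi_eigenvalue a b E /\ 2 < E]%R) (`|E - 2| `^ g)%R%:E <=
   (3 `^ (g - 1 / 2) * lt_const g)%:E *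
   (esumr (fun n => pospow (g + 1 / 2) (b n)) +
    2%:E * lp_sum (g + 1 / 2) (fun n => (a n - 1)%R)))%E.
Proof.
move=> g1 lb la; set p := g + 1 / 2.
have p1 : 1 <= p by rewrite /p; lra.
have p0 : 0 < p by lra.
have lt0 : 0 <= lt_const g.
  rewrite /lt_const /Lcl !mulr_ge0 ?pi_ge0 ?invr_ge0 ?sqrtr_ge0//.
    by rewrite fine_ge0// integral_ge0// => t _; rewrite lee_fin mulr_ge0 ?powR_ge0 ?expR_ge0.
  rewrite !mulr_ge0 ?sqrtr_ge0//.
  by rewrite fine_ge0// integral_ge0// => t _; rewrite lee_fin mulr_ge0 ?powR_ge0 ?expR_ge0.
have [Cb bC] := in_lp_bounded p0 lb; have [Ca aC] := in_lp_bounded p0 la.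
have bC' n : `|b n| <= Num.max Cb (Ca + 1) by rewrite (le_trans (bC n))// le_max lexx.
have aC' n : `|a n| <= Num.max Cb (Ca + 1).
  rewrite -[a n](subrK 1) (le_trans (ler_normD _ _))// normr1 le_max.
  by rewrite lerD2r aC orbT.
apply: (@le_trans _ _ ((lt_const g)%:E * esumr (fun n => pospow p (potential a b n))%R)%E).
  apply: ge_ereal_sup => _ [X [finX XS] <-].
  have XE E : E \in fset_set X -> jacobi_eigenvalue a b E /\ 2 < E.
    by rewrite in_fset_set// inE => /XS.
  rewrite fsbig_finite//= sumEFin.
  rewrite (eq_big_seq (fun E => pospow g (E - 2))); last first.
    by move=> E /XE[_ E2]; rewrite pospowE ?gtr0_norm ?subr_ge0 ?subr_gt0// ltW.
  apply: (lieb_thirring_seq aC' bC' g1) => //; first exact: fset_uniq.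
  by move=> E /XE[].
have E3 : (3 `^ (g - 1 / 2) * lt_const g)%:E = ((lt_const g)%:E * (3 `^ (p - 1))%:E)%E.
  by rewrite -EFinM mulrC; congr (_ * _ `^ _)%:E; rewrite /p; lra.
rewrite E3 -muleA lee_wpmul2l ?lee_fin//.
pose za n := `|a n - 1| `^ p.
have za0 n : 0 <= za n by exact: powR_ge0.
have -> : (2%:E * lp_sum p (fun n => (a n - 1)%R) =
    esumr za + esumr (fun n => za (n - 1)%R))%E.
  rewrite (esumr_reindex za (bij_addz (-1))).
  rewrite (_ : (2%:E = 1%:E + 1%:E :> \bar R)%E); last by rewrite -EFinD.
  by rewrite ge0_muleDl ?lee_fin// !mul1e.
rewrite -esumrD// -esumrD//; [|by move=> n; exact: pospow_ge0|by move=> n; rewrite addr_ge0].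
rewrite -esumrZ ?powR_ge0//; last by move=> n; rewrite !addr_ge0 ?pospow_ge0.
apply: le_esumr => n.
rewrite /potential pospowE ?addr_ge0 ?le_max ?lexx ?orbT// addrA.
by apply: powR_sum3 => //; rewrite le_max lexx orbT.
Qed.

Definition alt (u : int -> R) : int -> R :=
  fun n => (-1) ^ n * u n.

(** Conjugation by [(-1)^n] flips the sign of the neighbour terms only, so it carries the operator
    of [(a, b)] to minus that of [(a, -b)]. *)
Lemma jacobi_eigenvalue_opp a b (E : R) :
  jacobi_eigenvalue a b E -> jacobi_eigenvalue a (fun n => - b n) (- E).
Proof.
move=> [u [lu [u0 uE]]]; exists (alt u).
have n1 : (-1 : R) \is a GRing.unit by rewrite unitrN unitr1.
have nz n : (-1 : R) ^ n != 0 by rewrite expfz_neq0// oppr_eq0 oner_eq0.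
have sg n : `|(-1 : R) ^ n| = 1 by case: n => k; rewrite /exprz ?normfV normrX normrN1 expr1n ?invr1.
split; [|split].
- move: lu; rewrite /in_lp /lp_sum; congr (_ < _)%E; apply: eq_esum => n _.
  by rewrite /alt normrM sg mul1r.
- move=> au0; apply: u0; apply/funext => n.
  have /(congr1 (fun f => f n)) := au0; rewrite /alt => /eqP.
  by rewrite mulf_eq0 (negbTE (nz n)) => /eqP.
- move=> n; rewrite mulNr mulrCA -uE /jacobi /alt.
  have -> : (-1 : R) ^ (n + 1) = - (-1) ^ n.
    by rewrite exprzDr// expr1z mulrN1.
  have -> : (-1 : R) ^ (n - 1) = - (-1) ^ n.
    by rewrite exprzDr// exprN1 invrN1 mulrN1.
  by ring.
Qed.

End Assembly.

(** * Combining both ends of the spectrum *)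

Theorem theorem1p5 (R : realType) (g : R) (a b : int -> R)
  (hg : 1 <= g)
  (ha : forall n, 0 < a n)
  (hb : in_lp (g + 1 / 2) b)
  (ha1 : in_lp (g + 1 / 2) (fun n => a n - 1)) :
  (\esum_(E in [set E | jacobi_eigenvalue a b E /\ E < -2]%R) (`|E + 2| `^ g)%R%:E
   + \esum_(E in [set E | jacobi_eigenvalue a b E /\ 2 < E]%R) (`|E - 2| `^ g)%R%:E
   <= (3 `^ (g - 1 / 2) * (pi / Num.sqrt 3) * Lcl g)%R%:E
      * (lp_sum (g + 1 / 2) b + 4%:E * lp_sum (g + 1 / 2) (fun n => (a n - 1)%R)))%E.
Proof.
have below : (\esum_(E in [set E | jacobi_eigenvalue a b E /\ E < -2]%R) (`|E + 2| `^ g)%R%:E =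
   \esum_(E in [set E | jacobi_eigenvalue a (fun n => - b n) E /\ 2 < E]%R)
     (`|E - 2| `^ g)%R%:E)%E.
  rewrite (@reindex_esum _ _ _
    [set E | jacobi_eigenvalue a (fun n => - b n) E /\ 2 < E]%R _ (fun E => - E)%R).
    by apply: eq_esum => E _; rewrite -normrN opprD opprK.
  split=> [E /= [eE E2]|E E' _ _ /oppr_inj//|E /= [eE E2]].
  - split; last by rewrite ltrN2.
    have := jacobi_eigenvalue_opp eE.
    by under eq_fun do rewrite opprK.
  - exists (- E); last by rewrite opprK.
    by split; [exact: jacobi_eigenvalue_opp|rewrite ltrNr].
have p0 : 0 < g + 1 / 2 by lra.
have hb' : in_lp (g + 1 / 2) (fun n => - b n).
  by move: hb; rewrite /in_lp /lp_sum; under [in X in _ -> X]eq_esum do rewrite normrN.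
(* Eigenvalues below [-2] see only the negative part of [b], those above [2] only the positive part,
   so [b] is counted once. The [a] term occurs on both sides, giving [2 + 2 = 4]. *)
have bE : lp_sum (g + 1 / 2) b = (esumr (fun n => pospow (g + 1 / 2) (- b n)) +
    esumr (fun n => pospow (g + 1 / 2) (b n)))%E.
  rewrite -esumrD; [|by move=> n; exact: pospow_ge0..].
  apply: eq_esum => n _; congr EFin; have [b0|b0] := leP 0 (b n).
    by rewrite ger0_norm// (@pospow_le0 _ _ (- b n)) ?oppr_le0// add0r pospowE.
  by rewrite ltr0_norm// (@pospow_le0 _ _ (b n)) ?(ltW b0)// addr0 pospowE// oppr_ge0 ltW.
have := leeD (lieb_thirring_above hg hb' ha1) (lieb_thirring_above hg hb ha1).
rewrite below => /le_trans; apply; rewrite -mulrA -/(lt_const g).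
set Z := lp_sum _ (fun n => a n - 1).
have Z0 : (0 <= Z)%E by apply: esum_ge0 => n _; rewrite lee_fin powR_ge0.
have e0 (f : int -> R) : (0 <= esumr (fun n => pospow (g + 1 / 2) (f n)))%E.
  by apply: esumr_ge0 => n; exact: pospow_ge0.
have Z2 : (0 <= 2%:E * Z)%E by rewrite mule_ge0.
rewrite -ge0_muleDr ?adde_ge0// bE.
rewrite (_ : 4%:E = 2%:E + 2%:E :> \bar R)%E; last by rewrite -EFinD; congr EFin; ring.
by rewrite (ge0_muleDl Z)// addeACA.
Qed.
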